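(* With the notation of the context, the points in the intersection (in $\Gamma\backslash G$) of $\bigcup_{l=1}^h \Gamma g_l A g_0^{-1}$ with $\bigcup_{t\le T}\Gamma P_0a(t)$ correspond exactly to $$\tilde a(\mathcal{U}^+\xi)\in (g_l^{-1}\Gamma g_l\cap A)\backslash A$$ and $$\Gamma\begin{pmatrix}1 & \frac{\mu_1+a_1}{m_1} & \frac{\lambda}{m_1m_2}\\ 0&1&-\frac{\mu_2}{m_2}\\0&0&1\end{pmatrix}\begin{pmatrix}1&0&0\\0&m_2^{-1/2}&0\\0&0&m_2^{1/2}\end{pmatrix}\in\Gamma\backslash\Gamma P_0$$ with $N(\xi)=m_1^2m_2\le \mathrm{e}^{6T}$, where $\xi\in I_l^{-1}$ is totally positive, $F(\mu_j)\equiv 0 \bmod m_j$ for $j=1,2$, $\gcd(m_1,m_2,\mu_1-\mu_2)=1$, and where $\lambda$ is uniquely determined modulo $m_1m_2$ by $\mu_1$ and $\mu_2$ through the congruence given in the context.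
   Context: $G=\mathrm{SL}(3,\mathbb{R})$, $\Gamma=\mathrm{SL}(3,\mathbb{Z})$. $a(t)=\mathrm{diag}(\mathrm{e}^{-2t},\mathrm{e}^{t},\mathrm{e}^{t})$, $a_1(t_1)=\mathrm{diag}(1,\mathrm{e}^{-t_1},\mathrm{e}^{t_1})$, $A=\{a(t)a_1(t_1):t,t_1\in\mathbb{R}\}$ (the positive diagonal subgroup). $P_0\subset G$ is the subgroup of matrices whose first column is $(1,0,0)^{\mathsf T}$. $F(X)=X^3+a_1X^2+a_2X+a_3\in\mathbb{Z}[X]$ is a fixed irreducible polynomial with root $\alpha$, identified with the row vector $(\alpha^{(1)},\alpha^{(2)},\alpha^{(3)})$ of its images under the three embeddings of $\mathbb{Q}(\alpha)$; likewise any $\xi\in\mathbb{Q}(\alpha)$ is identified with $(\xi^{(1)},\xi^{(2)},\xi^{(3)})$. It is assumed that $\mathbb{Q}(\alpha)$ is totally real and that $\mathbb{Z}[\alpha]$ is a maximal order, i.e. the ring of integers of $\mathbb{Q}(\alpha)$. $g_0\in G$ is the matrix with rows $\alpha^2,\alpha,1$ (as row vectors), rescaled and with the embeddings ordered so that $\det g_0=1$. $I_1,\dots,I_h$ are representatives of the narrow ideal classes of $\mathbb{Z}[\alpha]$, and in the same way $g_1,\dots,g_h\in G$ are the rescaled basis matrices of $I_1,\dots,I_h$ (the rows of $g_l$ are a fixed $\mathbb{Z}$-basis of $I_l$, embedded as row vectors and rescaled to have determinant $1$). For totally positive $\xi\in\mathbb{Q}(\alpha)$, $\tilde a(\xi)=N(\xi)^{-1/3}\,\mathrm{diag}(\xi^{(1)},\xi^{(2)},\xi^{(3)})\in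 A$, where $N(\xi)$ is the norm of $\xi$. $\mathcal{U}^+$ is the group of totally positive units of $\mathbb{Z}[\alpha]$; via $\tilde a$ it is identified with $g_0^{-1}\Gamma g_0\cap A=g_l^{-1}\Gamma g_l\cap A$. In the correspondence, the first object is the $A$-coordinate and the second the $P_0$-coordinate of the intersection point: the point is $\Gamma g_l\tilde a(\xi)g_0^{-1}$, and it equals $\Gamma p\,a(t)$ with $\Gamma p$ the second object and $t=\frac16\log(m_1^2m_2)$. Definition of $\lambda$: $m_1,m_2$ are positive integers, $d=\gcd(m_1,m_2)$, and $\overline{m_1},\overline{m_2}$ are integers with $\frac{\overline{m_1}m_1}{d}+\frac{\overline{m_2}m_2}{d}=1$. Let $\kappa$ be the solution, unique modulo $d$ because $\gcd(m_1,m_2,\mu_1-\mu_2)=1$, of $$(\mu_2-\mu_1)\kappa\equiv\frac{F(\mu_1)}{m_1}\overline{m_2}+\frac{F(\mu_2)}{m_2}\overline{m_1}\pmod d.$$ Then $$\lambda\equiv(\mu_1^2+a_1\mu_1+a_2)\frac{\overline{m_2}m_2}{d}-(\mu_2^2+\mu_1\mu_2+a_1\mu_2)\frac{\overline{m_1}m_1}{d}+\kappa\frac{m_1m_2}{d}\pmod{m_1m_2}.$$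
   Formalization: The condition N(ξ)=m_1^2m_2 is replaced by N(ξ)N(I_l)=m_1^2m_2 (the printed one fails for representatives I_l of general norm, e.g. I_1=(η), N(η)=7); the P_0-coordinate Γp is taken together with m_1,m_2, since Γp alone does not determine the point. *)

(* Defs.v *)
From HB Require Import structures.
From mathcomp Require Import all_boot all_order all_algebra all_field.
From mathcomp Require Import boolp classical_sets reals sequences exp.
Set Implicit Arguments.
Unset Strict Implicit.
Unset Printing Implicit Defensive.
Import Order.TTheory GRing.Theory Num.Theory.
Local Open Scope classical_set_scope.
Local Open Scope ring_scope.

Definition mx3 (R : realType) (s : seq (seq R)) : 'M[R]_3 :=
  \matrix_(i, j) nth 0 (nth [::] s i) j.

Definition diag3 (R : realType) (x y z : R) : 'M[R]_3 :=
  mx3 [:: [:: x; 0; 0]; [:: 0; y; 0]; [:: 0; 0; z]].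

Definition Gamma (R : realType) : set 'M[R]_3 :=
  [set map_mx intr gam | gam in [set gam : 'M[int]_3 | \det gam = 1]].

Definition a_ (R : realType) (t : R) : 'M[R]_3 :=
  diag3 (expR (- 2 * t)) (expR t) (expR t).

Definition a1_ (R : realType) (t1 : R) : 'M[R]_3 :=
  diag3 1 (expR (- t1)) (expR t1).

Definition torus (R : realType) : set 'M[R]_3 :=
  [set m | exists t t1 : R, m = a_ t *m a1_ t1].

Definition P0 (R : realType) : set 'M[R]_3 :=
  [set p | \det p = 1 /\ col 0 p = delta_mx 0 0].

(* The coset H x.  A point of Gamma \ G is represented by the set
   [coset_pt (@Gamma R) g], g in SL(3, R). *)
Definition coset_pt (R : realType) (H : set 'M[R]_3) (x : 'M[R]_3) :
  set 'M[R]_3 := [set m *m x | m in H].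

Definition torus_orbit (R : realType) (gl g0 : 'M[R]_3) : set (set 'M[R]_3) :=
  [set coset_pt (@Gamma R) (gl *m a *m invmx g0) | a in @torus R].

Definition horo_orbit (R : realType) (t : R) : set (set 'M[R]_3) :=
  [set coset_pt (@Gamma R) (p *m a_ t) | p in @P0 R].

(* g^-1 Gamma g, intersected with A *)
Definition stab (R : realType) (g : 'M[R]_3) : set 'M[R]_3 :=
  [set invmx g *m gam *m g | gam in @Gamma R] `&` @torus R.

(* In odd dimension every invertible matrix has a unique real multiple of
   determinant 1; the real cube root of the determinant carries its sign. *)
Definition rescale (R : realType) (B : 'M[R]_3) : 'M[R]_3 :=
  (Num.sg (\det B) * `|\det B| `^ 3^-1)^-1 *: B.

Definition cubic (a1 a2 a3 : int) : {poly int} :=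
  'X^3 + a1%:P * 'X^2 + a2%:P * 'X + a3%:P.

Section NumberField.
Variables (R : realType) (L : fieldExtType rat).
Variables (alpha : L) (sigma : 'I_3 -> {rmorphism L -> R}).

Definition Zalpha : set L :=
  [set x | exists p : {poly int}, x = (map_poly intr p).[alpha]].

Definition totpos (x : L) : Prop := forall i, 0 < sigma i x.

Definition normK (x : L) : R := \prod_i sigma i x.

Definition emb_mx (b : 'I_3 -> L) : 'M[R]_3 := \matrix_(i, j) sigma j (b i).

Definition power_basis (i : 'I_3) : L := alpha ^+ (2 - i).

Definition frac_ideal (I : set L) : Prop :=
  [/\ forall x y, I x -> I y -> I (x - y),
      forall z x, Zalpha z -> I x -> I (z * x),
      exists2 x, I x & x != 0 &
      exists2 d, d != 0 & forall x, I x -> Zalpha (d * x)].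

Definition narrow_equiv (I J : set L) : Prop :=
  exists2 eta, totpos eta & J = [set eta * x | x in I].

Definition ideal_inv (I : set L) : set L :=
  [set x | forall y, I y -> Zalpha (x * y)].

Definition Zbasis (b : 'I_3 -> L) (I : set L) : Prop :=
  (forall x, I x <-> exists c : 'I_3 -> int, x = \sum_i b i *~ c i) /\
  (forall c : 'I_3 -> int, \sum_i b i *~ c i = 0 -> forall i, c i = 0).

(* Absolute norm (the generalized index [Z[alpha] : I]) of the fractional ideal
   I with Z-basis b, as a quotient of covolumes. *)
Definition ideal_norm (b : 'I_3 -> L) : R :=
  `|\det (emb_mx b)| / `|\det (emb_mx power_basis)|.

Definition units_pos : set L :=
  [set u | [/\ Zalpha u, Zalpha u^-1 & totpos u]].

Definition atilde (x : L) : 'M[R]_3 :=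
  (normK x) `^ (- 3^-1) *: diag_mx (\row_i sigma i x).

(* atilde (U^+ x) *)
Definition atilde_class (x : L) : set 'M[R]_3 :=
  [set atilde (u * x) | u in units_pos].

End NumberField.

Definition root_data (F : {poly int}) (m1 m2 mu1 mu2 : int) : Prop :=
  [/\ 0 < m1, 0 < m2, (F.[mu1] = 0 %[mod m1])%Z, (F.[mu2] = 0 %[mod m2])%Z &
      gcdz (gcdz m1 m2) (mu1 - mu2) = 1].

(* c1, c2 are the Bezout coefficients (overlined m1, m2).  All divisions are exact when
   [root_data] holds, and the residue of lam does not depend on the choice of
   c1, c2, kappa. *)
Definition lambda_spec (a1 a2 a3 m1 m2 mu1 mu2 lam : int) : Prop :=
  let F := cubic a1 a2 a3 in
  let d := gcdz m1 m2 in
  exists c1 c2 kappa : int,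
  [/\ c1 * (m1 %/ d)%Z + c2 * (m2 %/ d)%Z = 1,
      ((mu2 - mu1) * kappa =
         (F.[mu1] %/ m1)%Z * c2 + (F.[mu2] %/ m2)%Z * c1 %[mod d])%Z &
      (lam = (mu1 ^+ 2 + a1 * mu1 + a2) * (c2 * (m2 %/ d)%Z)
           - (mu2 ^+ 2 + mu1 * mu2 + a1 * mu2) * (c1 * (m1 %/ d)%Z)
           + kappa * ((m1 * m2) %/ d)%Z %[mod m1 * m2])%Z].

Definition p_mx (R : realType) (a1 m1 m2 mu1 mu2 lam : int) : 'M[R]_3 :=
  mx3 [:: [:: 1; (mu1 + a1)%:~R / m1%:~R; lam%:~R / (m1 * m2)%:~R];
          [:: 0; 1; - (mu2%:~R / m2%:~R)];
          [:: 0; 0; 1]] *m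
  diag3 1 (Num.sqrt m2%:~R)^-1 (Num.sqrt m2%:~R).

Definition horo_time (R : realType) (m1 m2 : int) : R :=
  6^-1 * ln (m1 ^+ 2 * m2)%:~R.

(* Main.v *)
(** The point Gamma g_l atilde(xi) g0^-1 is represented, up to a real scalar, by
   the integer matrix M expressing a basis of xi I_l in alpha^2, alpha, 1; since
   both sides have determinant 1, equalities of points need only be checked up to
   a scalar. If the point lies on Gamma P0 a(t), its first column is proportional
   to an integer vector, and inverting the rational matrix of alpha^2-coefficients
   of products of basis elements gives xi in I_l^-1 for which that column of M is
   (1, 0, 0). The Hermite form of M is then
   [[1, mu1 + a1, lam], [0, m1, - m1 mu2], [0, 0, m1 m2]], which represents
   p a(t). Stability of the row lattice under multiplication by alpha amounts
   to three congruences that are equivalent to F(mu_j) = 0 mod m_j together with the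
   congruence for lam, the condition gcd(m1, m2, mu1 - mu2) = 1 being forced by
   the maximality of Z[alpha]. Conversely such a matrix spans an ideal, which is
   xi I_l for exactly one l. *)
Require Import Defs.
From HB Require Import structures.
From mathcomp Require Import all_boot all_order all_algebra all_field.
From mathcomp Require Import boolp classical_sets reals sequences exp.
From mathcomp Require Import ring lra zify.
Set Implicit Arguments.
Unset Strict Implicit.
Unset Printing Implicit Defensive.
Import Order.TTheory GRing.Theory Num.Theory.
Local Open Scope classical_set_scope.
Local Open Scope ring_scope.


(** * The congruence for lambda *)

(** The obstacle is that a point of the intersection supplies only a real diagonal matrix [a], which
    must be recognised as coming from an element of the field. The link is the first column [v] of
    the inverse of the matrix of alpha^2, alpha, 1: its entries are 1 / F'(alpha^(j)), and pairing
    conjugates with [v] extracts the alpha^2-coefficient, which is rational on the field. No entry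
    of [v] vanishes, so a diagonal matrix is determined by its product with [v]; an x whose products
    with the basis have alpha^2-coefficients 1, 0, 0 therefore has conjugates proportional to the
    diagonal of [a]. The same functional tests membership in Z[alpha], which is self-dual for the
    pairing sending x, y to the alpha^2-coefficient of xy. The definition of lambda is reached
    indirectly: its solutions satisfy the three stability congruences, and those have at most one
    solution modulo m1 m2. *)

Lemma modz_eqP (d x y : int) : (x = y %[mod d])%Z <-> exists k, x = y + k * d.
Proof.
split=> [/eqP|[k ->]]; last by rewrite addrC modzMDl.
by rewrite eqz_mod_dvd => /dvdzP[k hk]; exists k; rewrite -hk addrC subrK.
Qed.

Lemma cubicE (a1 a2 a3 x : int) :
  (cubic a1 a2 a3).[x] = x ^+ 3 + a1 * x ^+ 2 + a2 * x + a3.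
Proof. by rewrite /cubic !hornerE. Qed.

(* The lattice spanned by alpha^2 + (mu1 + a1) alpha + lam, m1 (alpha - mu2) and
   m1 m2 is stable under multiplication by alpha; see [ideal_cond_mx] and
   [ideal_mx_cond]. *)
Definition ideal_cond (a1 a2 a3 m1 m2 mu1 mu2 lam : int) : Prop :=
  exists k q r : int,
  [/\ lam = mu1 ^+ 2 + a1 * mu1 + a2 + m1 * k,
      lam + (mu2 ^+ 2 + mu1 * mu2 + a1 * mu2) = m2 * q &
      (cubic a1 a2 a3).[mu1] + m1 * k * (mu1 - mu2) = m1 * m2 * r].

Section Lambda.
Variables (a1 a2 a3 m1 m2 mu1 mu2 : int).
Let F := cubic a1 a2 a3.
Hypothesis root_mu : root_data F m1 m2 mu1 mu2.

Lemma gcdz_split : exists d n1 n2 : int,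
  [/\ gcdz m1 m2 = d, m1 = n1 * d, m2 = n2 * d, [/\ 0 < d, 0 < n1 & 0 < n2] &
   [/\ (m1 %/ d)%Z = n1, (m2 %/ d)%Z = n2,
       ((m1 * m2) %/ d)%Z = n1 * n2 * d & coprimez n1 n2]].
Proof.
case: root_mu => m1p m2p _ _ _.
have dp : 0 < gcdz m1 m2 by rewrite lt_def gcdz_eq0 (gt_eqF m1p).
case/dvdzP: (dvdz_gcdl m1 m2) => n1 e1; case/dvdzP: (dvdz_gcdr m1 m2) => n2 e2.
have [u [v euv]] := Bezoutz m1 m2.
exists (gcdz m1 m2), n1, n2; move: (gcdz m1 m2) dp e1 e2 euv => d dp e1 e2 euv.
have d0 : d != 0 by rewrite gt_eqF.
split=> //; first by split=> //; rewrite -(pmulr_lgt0 _ dp) -?e1 -?e2.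
rewrite e1 e2 !mulzK //; split=> //.
  by rewrite mulrACA mulrA mulzK //; ring.
apply/coprimezP; exists (u, v) => /=.
by apply: (mulIf d0); rewrite -{2}euv {1}e1 {1}e2; ring.
Qed.

(** Put P = mu1^2 + a1 mu1 + a2 and Q = mu2^2 + mu1 mu2 + a1 mu2. Then S = P + Q is the divided
    difference of F at mu1, mu2, and d divides it because d is prime to mu1 - mu2; so the residues P
    mod m1 and -Q mod m2 are compatible. The Bezout combination glues them modulo m1 m2 / d, and
    kappa settles the remaining factor d through the third congruence. *)
Lemma lambda_spec_ideal_cond (lam : int) :
  lambda_spec a1 a2 a3 m1 m2 mu1 mu2 lam -> ideal_cond a1 a2 a3 m1 m2 mu1 mu2 lam.
Proof.
case: gcdz_split => d [n1 [n2 [ed e1 e2 [dp n1p n2p] [q1 q2 q12 _]]]].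
case: root_mu => m1p m2p; rewrite !mod0z.
move=> /dvdz_mod0P /dvdzP[f1 hf1] /dvdz_mod0P /dvdzP[f2 hf2].
rewrite ed => hg; rewrite /lambda_spec ed q1 q2 q12 => -[c1 [c2 [kappa]]].
rewrite -/F hf1 hf2 !mulzK ?gt_eqF //.
case=> bez /modz_eqP[e he] /modz_eqP[e' he'].
set S := mu1 ^+ 2 + mu1 * mu2 + mu2 ^+ 2 + a1 * (mu1 + mu2) + a2.
have SE : F.[mu1] - F.[mu2] = (mu1 - mu2) * S by rewrite /F !cubicE /S; ring.
have /dvdzP[s hs] : (d %| S)%Z.
  have co : coprimez d (mu1 - mu2) by rewrite /coprimez hg.
  rewrite -(Gauss_dvdzr _ co) -SE hf1 hf2 e1 e2 !mulrA -mulrBl.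
  exact: dvdz_mull.
have d0 : d != 0 by rewrite gt_eqF.
have sE : s * (mu1 - mu2) = f1 * n1 - f2 * n2.
  apply: (mulIf d0); transitivity ((mu1 - mu2) * S); first by rewrite hs; ring.
  by rewrite -SE hf1 hf2 e1 e2; ring.
have -> : lam = mu1 ^+ 2 + a1 * mu1 + a2 - S * (c1 * n1) + kappa * (n1 * n2 * d)
            + e' * (m1 * m2).
  rewrite he'; congr (_ + _ + _).
  have -> : c2 * n2 = 1 - c1 * n1 by rewrite -bez; ring.
  by rewrite /S; ring.
exists (kappa * n2 - s * c1 + e' * m2).
exists (s * c2 + kappa * n1 + e' * m1).
exists (- e + e' * (mu1 - mu2)).
split.
- by rewrite hs e1; ring.
- have -> : c1 * n1 = 1 - c2 * n2 by rewrite -bez; ring.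
  transitivity (S * c2 * n2 + kappa * (n1 * n2 * d) + e' * (m1 * m2)).
    by rewrite /S; ring.
  by rewrite hs e2; ring.
- rewrite hf1.
  transitivity (m1 * (f1 - c1 * (s * (mu1 - mu2)) + kappa * n2 * (mu1 - mu2)
      + e' * m2 * (mu1 - mu2))); first by ring.
  rewrite sE.
  have -> : f1 - c1 * (f1 * n1 - f2 * n2)
    = f1 * (1 - c1 * n1) + c1 * f2 * n2 by ring.
  have -> : 1 - c1 * n1 = c2 * n2 by rewrite -bez; ring.
  transitivity (m1 * (n2 * (f1 * c2 + f2 * c1 - (mu2 - mu1) * kappa)
     + e' * m2 * (mu1 - mu2))); first by ring.
  by rewrite he e2; ring.
Qed.

Lemma lambda_spec_exists : exists lam, lambda_spec a1 a2 a3 m1 m2 mu1 mu2 lam.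
Proof.
case: gcdz_split => d [n1 [n2 [ed e1 e2 [dp n1p n2p] [q1 q2 q12 co]]]].
case: root_mu => m1p m2p _ _; rewrite ed => hg.
case/coprimezP: co => -[c1 c2] /= bez.
have /coprimezP[[u v] /= huv] : coprimez d (mu1 - mu2) by rewrite /coprimez hg.
rewrite /lambda_spec ed q1 q2 q12.
set P := mu1 ^+ 2 + _ + _; set Q := mu2 ^+ 2 + _ + _.
set G := (F.[mu1] %/ m1)%Z * c2 + (F.[mu2] %/ m2)%Z * c1.
(* v inverts mu1 - mu2 modulo d, hence kappa = - v G. *)
exists (P * (c2 * n2) - Q * (c1 * n1) + - (v * G) * (n1 * n2 * d)).
exists c1, c2, (- (v * G)); split=> //.
apply/modz_eqP; exists (- (u * G)).
rewrite -/F -/G; transitivity (v * (mu1 - mu2) * G); first by ring.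
have -> : v * (mu1 - mu2) = 1 - u * d by rewrite -huv; ring.
by ring.
Qed.

Lemma lambda_spec_mod (lam lam' : int) :
  (lam' = lam %[mod m1 * m2])%Z ->
  lambda_spec a1 a2 a3 m1 m2 mu1 mu2 lam -> lambda_spec a1 a2 a3 m1 m2 mu1 mu2 lam'.
Proof.
by move=> e [c1 [c2 [kap [h1 h2 h3]]]]; exists c1, c2, kap; split=> //; rewrite e.
Qed.

(** The first two equations make k' - k divisible by m2 / d. The third, with mu1 - mu2 invertible
    modulo d, gives the missing factor d, and lam' - lam = m1 (k' - k). *)
Lemma ideal_cond_unique (lam lam' : int) :
  ideal_cond a1 a2 a3 m1 m2 mu1 mu2 lam -> ideal_cond a1 a2 a3 m1 m2 mu1 mu2 lam' ->
  (lam' = lam %[mod m1 * m2])%Z.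
Proof.
case: gcdz_split => d [n1 [n2 [ed e1 e2 [dp n1p n2p] [_ _ _ co]]]].
case: root_mu => m1p m2p _ _; rewrite ed => hg.
move=> [k [q [r [h1 h2 h3]]]] [k' [q' [r' [h1' h2' h3']]]].
have n20 : n2 != 0 by rewrite gt_eqF.
have d0 : d != 0 by rewrite gt_eqF.
have m10 : m1 != 0 by rewrite gt_eqF.
have kq : n1 * (k' - k) = n2 * (q' - q).
  by apply: (mulIf d0); rewrite mulrAC -e1 mulrAC -e2 !mulrBr -h2 -h2' h1 h1'; ring.
have /dvdzP[z hz] : (n2 %| k' - k)%Z.
  have co' : coprimez n2 n1 by rewrite coprimez_sym.
  by rewrite -(Gauss_dvdzr _ co') kq dvdz_mulr.
have hr : (k' - k) * (mu1 - mu2) = m2 * (r' - r).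
  apply: (mulfI m10); rewrite [RHS]mulrA [m1 * m2 * _]mulrBr -h3 -h3'; ring.
have /dvdzP[w hw] : (d %| z)%Z.
  have co' : coprimez d (mu1 - mu2) by rewrite /coprimez hg.
  rewrite -(Gauss_dvdzl _ co'); apply/dvdzP; exists (r' - r).
  by apply: (mulfI n20); rewrite mulrA [n2 * z]mulrC -hz hr e2; ring.
apply/modz_eqP; exists w.
rewrite h1' h1; have -> : k' = k + z * n2 by rewrite -hz; ring.
by rewrite hw e2; ring.
Qed.

(** The converse avoids recovering kappa: some l0 satisfies [lambda_spec], hence [ideal_cond];
    uniqueness makes lam congruent to l0, and [lambda_spec] sees lam only modulo m1 m2. *)
Lemma lambda_specP (lam : int) :
  lambda_spec a1 a2 a3 m1 m2 mu1 mu2 lam <-> ideal_cond a1 a2 a3 m1 m2 mu1 mu2 lam.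
Proof.
split; first exact: lambda_spec_ideal_cond.
case: lambda_spec_exists => l0 h0 h.
apply: (lambda_spec_mod _ h0); apply: ideal_cond_unique => //.
exact: lambda_spec_ideal_cond.
Qed.

Lemma lambda_unique : exists lam, forall lam',
  lambda_spec a1 a2 a3 m1 m2 mu1 mu2 lam' <-> (lam' = lam %[mod m1 * m2])%Z.
Proof.
case: lambda_spec_exists => l0 h0; exists l0 => l'; split.
  by move=> /lambda_specP h; apply: ideal_cond_unique => //; apply/lambda_specP.
by move=> h; apply: (lambda_spec_mod _ h0).
Qed.

End Lambda.

(** The first two equations express the divided difference of F at mu1, mu2 as m2 q - m1 k, so the
    third becomes F(mu2) = m1 m2 r - (mu1 - mu2) m2 q. *)
Lemma ideal_cond_roots (a1 a2 a3 m1 m2 mu1 mu2 lam : int) :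
  ideal_cond a1 a2 a3 m1 m2 mu1 mu2 lam ->
  ((cubic a1 a2 a3).[mu1] = 0 %[mod m1])%Z /\
  ((cubic a1 a2 a3).[mu2] = 0 %[mod m2])%Z.
Proof.
move=> [k [q [r [h1 h2 h3]]]]; split; apply/modz_eqP.
  exists (m2 * r - k * (mu1 - mu2)); apply: (addIr (m1 * k * (mu1 - mu2))).
  by rewrite [LHS]h3; ring.
exists (m1 * r - (mu1 - mu2) * q).
rewrite add0r mulrBl.
transitivity (m1 * m2 * r - (mu1 - mu2) * (m2 * q)); last by ring.
by rewrite -h3 -h2 h1 !cubicE; ring.
Qed.

(** * Matrices, the torus and cosets *)

Local Notation o0 := (@Ordinal 3 0 isT).
Local Notation o1 := (@Ordinal 3 1 isT).
Local Notation o2 := (@Ordinal 3 2 isT).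

(** Produces literal ordinals, on which matrix entries given by [nth] compute. *)
Lemma ord3_ind (P : 'I_3 -> Prop) : P o0 -> P o1 -> P o2 -> forall i, P i.
Proof.
move=> P0 P1 P2 [[|[|[|//]]] hi].
- by rewrite (_ : Ordinal hi = o0) //; apply: val_inj.
- by rewrite (_ : Ordinal hi = o1) //; apply: val_inj.
- by rewrite (_ : Ordinal hi = o2) //; apply: val_inj.
Qed.

Lemma sum3E (V : nmodType) (f : 'I_3 -> V) : \sum_i f i = f o0 + f o1 + f o2.
Proof.
rewrite !big_ord_recr big_ord0 /= add0r.
by congr (f _ + f _ + f _); apply: val_inj.
Qed.

Lemma prod3E (S : comNzRingType) (f : 'I_3 -> S) : \prod_i f i = f o0 * f o1 * f o2.
Proof.
rewrite !big_ord_recr big_ord0 /= mul1r.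
by congr (f _ * f _ * f _); apply: val_inj.
Qed.

Lemma det3E (S : comNzRingType) (M : 'M[S]_3) :
  \det M = M o0 o0 * (M o1 o1 * M o2 o2 - M o1 o2 * M o2 o1)
         - M o0 o1 * (M o1 o0 * M o2 o2 - M o1 o2 * M o2 o0)
         + M o0 o2 * (M o1 o0 * M o2 o1 - M o1 o1 * M o2 o0).
Proof.
pose z := @Ordinal 2 0 isT; pose u := @Ordinal 2 1 isT.
have sum2 (f : 'I_2 -> S) : \sum_i f i = f z + f u.
  by rewrite !big_ord_recr big_ord0 /= add0r; congr (f _ + f _); apply: val_inj.
have det2 (N : 'M[S]_2) : \det N = N z z * N u u - N z u * N u z.
  rewrite (expand_det_row _ z) sum2 /cofactor !det_mx11 !mxE /=.
  have -> : lift z (0 : 'I_1) = u by apply: val_inj.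
  have -> : lift u (0 : 'I_1) = z by apply: val_inj.
  by rewrite /= expr0 expr1; ring.
rewrite (expand_det_row _ o0) sum3E /cofactor !det2 !mxE /=.
have -> : lift o0 z = o1 by apply: val_inj.
have -> : lift o0 u = o2 by apply: val_inj.
have -> : lift o1 z = o0 by apply: val_inj.
have -> : lift o1 u = o2 by apply: val_inj.
have -> : lift o2 z = o0 by apply: val_inj.
have -> : lift o2 u = o1 by apply: val_inj.
by rewrite /= !expr0 expr1 expr2; ring.
Qed.

Lemma mx3_unit_det1 (S : comUnitRingType) (M : 'M[S]_3) : \det M = 1 -> M \in unitmx.
Proof. by move=> e; rewrite unitmxE e unitr1. Qed.

(** The scalar satisfies k^3 = 1, and k^2 + k + 1 has no real zero. *)
Lemma det1_proportional_eq (K : realFieldType) (M N : 'M[K]_3) (k : K) :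
  \det M = 1 -> \det N = 1 -> N = k *: M -> N = M.
Proof.
move=> dM dN e; move: dN; rewrite e detZ dM mulr1 => k3.
suff -> : k = 1 by rewrite scale1r.
have : (k - 1) * (k ^+ 2 + k + 1) = 0 
  by transitivity (k ^+ 3 - 1); [ring|rewrite k3 subrr].
by move/eqP; rewrite mulf_eq0 => /orP[/eqP|/eqP]; nra.
Qed.

Section RealMatrices.
Variable R : realType.
Implicit Types (M N : 'M[R]_3) (d : 'rV[R]_3) (H : set 'M[R]_3).

Lemma diag3E (x y z : R) : diag3 x y z = diag_mx (\row_i [:: x; y; z]`_i).
Proof.
apply/matrixP; elim/ord3_ind; elim/ord3_ind; rewrite !mxE /= ?mulr1n ?mulr0n //.
Qed.

Lemma mul_diag3 (x y z x' y' z' : R) :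
  diag3 x y z *m diag3 x' y' z' = diag3 (x * x') (y * y') (z * z').
Proof.
rewrite !diag3E mulmx_diag; congr diag_mx; apply/rowP.
by elim/ord3_ind; rewrite !mxE.
Qed.

Lemma torusP M : torus M <->
  exists d, [/\ M = diag_mx d, forall i, 0 < d 0 i & \prod_i d 0 i = 1].
Proof.
split=> [[t [t1 ->]]|[d [-> dpos d1]]].
  exists (\row_i [:: expR (- 2 * t); expR (t - t1); expR (t + t1)]`_i); split.
  - by rewrite /a_ /a1_ mul_diag3 diag3E mulr1 -!expRD.
  - by elim/ord3_ind; rewrite mxE /= expR_gt0.
  - by rewrite prod3E !mxE /= -!expRD -[RHS]expR0; congr expR; ring.
(* These solve exp(-2t) = d0 and exp(t - t1) = d1; the last entry is forced by the product being
   1. *)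
pose t := - ln (d 0 o0) / 2; pose t1 := t - ln (d 0 o1); exists t, t1.
rewrite /a_ /a1_ mul_diag3 diag3E; congr diag_mx; apply/rowP.
have e2 : d 0 o2 = expR (- ln (d 0 o0) - ln (d 0 o1)).
  rewrite expRD !expRN !lnK ?posrE //.
  apply: (mulfI (lt0r_neq0 (mulr_gt0 (dpos o0) (dpos o1)))).
  by rewrite -[LHS](prod3E (fun i => d 0 i)) d1; field; rewrite !gt_eqF.
elim/ord3_ind; rewrite mxE /= ?e2 -?expRD ?mulr1.
- by rewrite (_ : -2 * t = ln (d 0 o0)) ?lnK ?posrE // /t; field.
- by rewrite (_ : t - t1 = ln (d 0 o1)) ?lnK ?posrE // /t1; ring.
- by congr expR; rewrite /t1 /t; field.
Qed.

Lemma torus_det M : torus M -> \det M = 1.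
Proof. by move=> /torusP[d [-> _ d1]]; rewrite det_diag. Qed.

Lemma a_torus (t : R) : torus (a_ t).
Proof.
exists t, 0; rewrite /a1_ mul_diag3 oppr0 expR0 !mulr1 //.
Qed.

Lemma a_unit (t : R) : a_ t \in unitmx.
Proof. exact/mx3_unit_det1/torus_det/a_torus. Qed.

(** Isolated so that one coset criterion serves both [Gamma] and the stabilisers [stab]. *)
Definition mx_group H : Prop :=
  [/\ H 1%:M, forall M N, H M -> H N -> H (M *m N) &
      forall M, H M -> M \in unitmx /\ H (invmx M)].

Lemma coset_ptP H M N : mx_group H ->
  coset_pt H M = coset_pt H N <-> exists2 g, H g & M = g *m N.
Proof.
case=> H1 HM HV; split=> [e|[g Hg ->]].
  have : coset_pt H M M by exists 1%:M => //; rewrite mul1mx.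
  by rewrite e => -[g Hg <-]; exists g.
have [gU gV] := HV _ Hg.
apply/seteqP; split=> _ [k Hk <-].
  by exists (k *m g); [exact: HM|rewrite mulmxA].
by exists (k *m invmx g); [exact: HM|rewrite -mulmxA mulKmx].
Qed.

Lemma Gamma_group : mx_group (@Gamma R).
Proof.
split=> [|_ _ [g dg <-] [k dk <-]|_ [g dg <-]].
- by exists 1%:M; rewrite /= ?det1 ?map_mx1.
- by exists (g *m k); rewrite /= ?map_mxM ?det_mulmx ?dg ?dk ?mulr1.
- have U : map_mx (intr : int -> R) g \in unitmx.
    by apply: mx3_unit_det1; rewrite det_map_mx dg.
  split=> //; exists (invmx g); first by rewrite /= det_inv dg invr1.
  apply: (can_inj (mulKmx U)).
  by rewrite mulmxV // -map_mxM mulmxV ?map_mx1 // mx3_unit_det1.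
Qed.

Lemma torus_group : mx_group (@torus R).
Proof.
split=> [|M N /torusP[d [-> dp d1]] /torusP[e [-> ep e1]]|M /[dup] /torus_det dM].
- apply/torusP; exists (const_mx 1); split; first by rewrite diag_const_mx.
    by move=> i; rewrite mxE.
  by rewrite big1 // => i _; rewrite mxE.
- apply/torusP; rewrite mulmx_diag; eexists; split; first by [].
    by move=> i; rewrite mxE mulr_gt0.
  transitivity (\prod_i d 0 i * \prod_i e 0 i); last by rewrite d1 e1 mulr1.
  by rewrite -big_split; apply: eq_bigr => i _; rewrite mxE.
move=> /torusP[d [eM dp d1]]; have MU := mx3_unit_det1 dM; split=> //.
apply/torusP; exists (\row_i (d 0 i)^-1); split.
- apply: (can_inj (mulKmx MU)); rewrite mulmxV // eM mulmx_diag -diag_const_mx.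
  by congr diag_mx; apply/rowP => i; rewrite !mxE divff ?gt_eqF.
- by move=> i; rewrite mxE invr_gt0.
- transitivity (\prod_i d 0 i)^-1; last by rewrite d1 invr1.
  by rewrite -prodfV; apply: eq_bigr => i _; rewrite mxE.
Qed.

Lemma stab_group (g : 'M[R]_3) : g \in unitmx -> mx_group (stab g).
Proof.
move=> gU; have [G1 GM GV] := Gamma_group; have [A1 AM AV] := torus_group.
split=> [|M N [[x Gx ex] AMM] [[y Gy ey] ANN]|M [[x Gx ex] AMM]].
- by split=> //; exists 1%:M => //; rewrite mulmx1 mulVmx.
- split; last exact: AM.
  by exists (x *m y); [exact: GM|rewrite -ex -ey !mulmxA mulmxK].
have [xU Gx'] := GV _ Gx; have [MU AM'] := AV _ AMM.
split=> //; split=> //; exists (invmx x) => //.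
apply: (can_inj (mulKmx MU)); rewrite mulmxV // -ex !mulmxA.
by rewrite mulmxK // mulmxK // mulVmx.
Qed.

Lemma rescale_pos M : 0 < \det M ->
  exists2 c : R, 0 < c & rescale M = c *: M /\ \det (rescale M) = 1.
Proof.
move=> dp; exists (\det M `^ 3^-1)^-1; first by rewrite invr_gt0 powR_gt0.
have e : rescale M = (\det M `^ 3^-1)^-1 *: M.
  by rewrite /rescale gtr0_sg // mul1r gtr0_norm.
split=> //; rewrite e detZ exprVn -powR_mulrn ?powR_ge0 // -powRrM.
by rewrite mulVf ?pnatr_eq0 // powRr1 ?ltW // mulVf ?gt_eqF.
Qed.

(** In dimension 3 negation flips the determinant, and the sign in [rescale] undoes this; a basis of
    negative determinant can thus be replaced by its opposite. *)
Lemma rescaleN M : rescale (- M) = rescale M.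
Proof.
rewrite /rescale (_ : \det (- M) = - \det M); last first.
  by rewrite -scaleN1r detZ -signr_odd /= expr1 mulN1r.
by rewrite normrN sgrN mulNr invrN scaleNr scalerN opprK.
Qed.

End RealMatrices.

(** * Integer row lattices *)

(* Row vectors below are coordinates with respect to alpha^2, alpha, 1;
   multiplication by alpha is then right multiplication by this matrix. *)
Definition companion (a1 a2 a3 : int) : 'M[int]_3 :=
  \matrix_(i, j) nth 0 (nth [::] [:: [:: - a1; - a2; - a3]; [:: 1; 0; 0]; [:: 0; 1; 0]] i) j.

Definition ideal_mx (a1 m1 m2 mu1 mu2 lam : int) : 'M[int]_3 :=
  \matrix_(i, j) nth 0 (nth [::]
    [:: [:: 1; mu1 + a1; lam]; [:: 0; m1; - (m1 * mu2)]; [:: 0; 0; m1 * m2]] i) j.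

Lemma mulmx3E (S : pzSemiRingType) m n (M : 'M[S]_(m, 3)) (N : 'M_(3, n)) i j :
  (M *m N) i j = M i o0 * N o0 j + M i o1 * N o1 j + M i o2 * N o2 j.
Proof. by rewrite mxE sum3E. Qed.

Lemma det_ideal_mx (a1 m1 m2 mu1 mu2 lam : int) :
  \det (ideal_mx a1 m1 m2 mu1 mu2 lam) = m1 ^+ 2 * m2.
Proof. by rewrite det3E !mxE /=; ring. Qed.

Lemma ideal_cond_mx (a1 a2 a3 m1 m2 mu1 mu2 lam : int) :
  ideal_cond a1 a2 a3 m1 m2 mu1 mu2 lam ->
  exists X : 'M[int]_3, ideal_mx a1 m1 m2 mu1 mu2 lam *m companion a1 a2 a3 =
    X *m ideal_mx a1 m1 m2 mu1 mu2 lam.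
Proof.
case=> k [q [r [h1 h2]]]; rewrite cubicE => h3.
(* X is multiplication by alpha on the rows, found by substitution along the triangular shape; k, q
   and r are exactly the quotients that this substitution requires to be integers. *)
exists (\matrix_(i, j) nth 0 (nth [::] [:: [:: mu1; k; - r];
   [:: m1; - (mu1 + mu2 + a1); - q]; [:: 0; m2; mu2]] i) j).
have {}h2 : m1 * (m2 * q) = m1 * (lam + (mu2 ^+ 2 + mu1 * mu2 + a1 * mu2)) by rewrite h2.
apply/matrixP; elim/ord3_ind; elim/ord3_ind; rewrite !mulmx3E !mxE /=; try ring.
- by rewrite h1; ring.
- apply/eqP; rewrite -subr_eq0; apply/eqP.
  transitivity (m1 * m2 * r - mu1 * lam - a3 + k * m1 * mu2); first by ring.
  by rewrite -h3 h1; ring.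
- apply/eqP; rewrite -subr_eq0; apply/eqP.
  transitivity (m1 * (m2 * q) - m1 * lam - (mu1 + mu2 + a1) * (m1 * mu2)); first by ring.
  by rewrite h2; ring.
Qed.

(** The bottom row of the matrix equation forces W22 = X21 W11 and W12 = - W11 X22, which are the
    divisibilities built into [ideal_mx]. The remaining entries of X supply k, q, r up to sign. *)
Lemma ideal_mx_cond (a1 a2 a3 : int) (W X : 'M[int]_3) :
  W o0 o0 = 1 -> W o1 o0 = 0 -> W o2 o0 = 0 -> W o2 o1 = 0 ->
  0 < W o1 o1 -> 0 < W o2 o2 -> W *m companion a1 a2 a3 = X *m W ->
  exists m1 m2 mu1 mu2 lam, [/\ 0 < m1, 0 < m2, W = ideal_mx a1 m1 m2 mu1 mu2 lam &
    ideal_cond a1 a2 a3 m1 m2 mu1 mu2 lam].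
Proof.
move=> w00 w10 w20 w21 Dp Gp eX.
have E i j : (W *m companion a1 a2 a3) i j = (X *m W) i j by rewrite eX.
have := E o0 o0; have := E o0 o1; have := E o0 o2.
have := E o1 o0; have := E o1 o1; have := E o1 o2.
have := E o2 o0; have := E o2 o1; have := E o2 o2.
rewrite !mulmx3E w00 w10 w20 w21 !mxE /= !(mulr0, mulr1, mul0r, mul1r, addr0, add0r).
move: (X o0 o0) (X o0 o1) (X o0 o2) (X o1 o0) (X o1 o1) (X o1 o2).
move: (X o2 o0) (X o2 o1) (X o2 o2).
move=> x20 x21 x22 x00 x01 x02 x10 x11 x12 e22 e21 e20 e12 e11 e10 e02 e01 e00.
move: e22 e21; rewrite -e20 !(mul0r, add0r) => e22 e21.
set D := W o1 o1 in Dp e21 e22 e10 e11 e12 e01 e02 *.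
set G := W o2 o2 in Gp e21 e22 e10 e11 e12 e01 e02 *.
have D0 : D != 0 by rewrite gt_eqF.
have x21p : 0 < x21 by rewrite -(pmulr_lgt0 _ Dp) -e21.
have eE : W o1 o2 = - (D * x22).
  apply: (mulfI (lt0r_neq0 x21p)); apply/eqP; rewrite -subr_eq0; apply/eqP.
  by rewrite [RHS]e22 e21; ring.
exists D, x21, (W o0 o1 - a1), x22, (W o0 o2); split=> //.
  apply/matrixP; elim/ord3_ind; elim/ord3_ind; rewrite !mxE //=; first by rewrite subrK.
  by rewrite -/G e21 mulrC.
rewrite eE in e22 e12 e02 e11.
have e11' : W o0 o1 + x11 = - x22.
  by apply: (mulfI D0); rewrite mulrN e11 -e10; ring.
exists x01, (- x12), (- x02); split.
- have := e01; rewrite -e00 => h.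
  transitivity (- a2 + W o0 o2 + a2); first by ring.
  have -> : - a2 + W o0 o2 = - a1 * W o0 o1 + W o0 o1 * W o0 o1 + x01 * D.
    by rewrite -mulrDl -h; ring.
  by ring.
- apply: (mulfI D0); apply/eqP; rewrite -subr_eq0; apply/eqP.
  transitivity (x10 * W o0 o2 + x11 * - (D * x22) + x12 * G); last by rewrite -e12.
  have -> : x11 = - x22 - W o0 o1 by rewrite -e11'; ring.
  by rewrite e21 -e10; ring.
- rewrite cubicE; move: e01 e02; rewrite -e00 e21 => h1 h2.
  have hl : W o0 o2 = a2 + (- a1 + W o0 o1) * W o0 o1 + x01 * D by rewrite -addrA -h1; ring.
  apply/eqP; rewrite -subr_eq0; apply/eqP.
  transitivity ((- a1 + W o0 o1) * (a2 + (- a1 + W o0 o1) * W o0 o1 + x01 * D)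
    - x01 * (D * x22) + x02 * (x21 * D) + a3); first by ring.
  by rewrite -hl; rewrite mulrN in h2; rewrite -h2; ring.
Qed.

Lemma sqr_int_unit (d : int) : d \is a GRing.unit -> d ^+ 2 = 1.
Proof. by rewrite qualifE /= => /orP[] /eqP ->. Qed.

(** The Smith form of a column has a single nonzero entry, at the top, so the inverse of its left
    factor does what is wanted up to signs. *)
Lemma primitive_col (v : 'cV[int]_3) : v != 0 ->
  exists (g : 'M[int]_3) (m : int), [/\ \det g = 1, 0 < m & g *m v = m *: delta_mx 0 0].
Proof.
move=> v0; have [P PU [Q QU [d _ ev]]] := int_Smith_normal_form v.
set D := (X in P *m X *m Q) in ev.
have eD : D = d`_0 *: delta_mx 0 0.
  apply/matrixP => i j; rewrite !mxE (ord1 j) eqxx andbT.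
  by case: i => [[|i] hi]; rewrite /= ?mulr1n ?mulr1 ?mulr0n ?mulr0.
pose m := d`_0 * Q 0 0.
have eQ : Q = (Q 0 0)%:M by rewrite [LHS]mx11_scalar.
have em : invmx P *m v = m *: delta_mx 0 0.
  rewrite ev -mulmxA mulKmx // eQ mul_mx_scalar eD scalerA /m mulrC //.
have m0 : m != 0.
  apply: contra v0 => /eqP m0; rewrite -(mulKVmx PU v) em m0 scale0r mulmx0 //.
pose e := \det (invmx P).
have e2 : e ^+ 2 = 1 by apply: sqr_int_unit; rewrite -unitmxE unitmx_inv.
(* The first sign makes the content positive; the last acts on a zero of the column and brings the
   total determinant to 1. *)
pose E := diag_mx (\row_i [:: Num.sg m; 1; Num.sg m * e]`_i) : 'M[int]_3.
exists (E *m invmx P), `|m|; split; last 2 first.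
- by rewrite normr_gt0.
- rewrite -mulmxA em; apply/matrixP => i j; rewrite (ord1 j) mulmx3E !mxE /=.
  elim/ord3_ind: i; rewrite /= ?mulr1n ?mulr0n !(mulr0, mul0r, addr0, mulr1) //.
  by rewrite -normrEsg.
- rewrite det_mulmx det_diag prod3E !mxE /= -/e mulr1 mulrA.
  by rewrite -expr2 sqr_sg m0 mul1r -expr2.
Qed.

(** The first column being (1, 0, 0), only the lower right block changes: a Bezout matrix sends its
    first column (p, r) to (gcd(p, r), 0). Entries above the diagonal stay unreduced, since mu1, mu2
    and lam may be any integers. *)
Lemma hnf_of_primitive (M : 'M[int]_3) :
  M o0 o0 = 1 -> M o1 o0 = 0 -> M o2 o0 = 0 -> 0 < \det M ->
  exists2 g : 'M[int]_3, \det g = 1 &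
  let W := g *m M in [/\ W o0 o0 = 1, W o1 o0 = 0, W o2 o0 = 0, W o2 o1 = 0 &
     0 < W o1 o1 /\ 0 < W o2 o2].
Proof.
move=> m00 m10 m20; rewrite det3E m00 m10 m20.
set p := M o1 o1; set q := M o1 o2; set r := M o2 o1; set s := M o2 o2.
rewrite !(mul0r, mulr0, subr0, mul1r, addr0, add0r) => dp.
have [u [v euv]] := Bezoutz p r.
have D0 : gcdz p r != 0.
  apply: contraTneq dp => /eqP; rewrite gcdz_eq0 => /andP[/eqP-> /eqP->].
  by rewrite mul0r mulr0 subr0 ltxx.
case/dvdzP: (dvdz_gcdl p r) => p' ep; case/dvdzP: (dvdz_gcdr p r) => r' er.
have : 0 < gcdz p r by rewrite lt_def D0.
move: (gcdz p r) D0 euv ep er => D D0 euv ep er Dp.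
have bez : u * p' + v * r' = 1.
  apply: (mulIf D0); rewrite mul1r; transitivity (u * p + v * r) => //.
  by rewrite [in RHS]ep [in RHS]er; ring.
exists (\matrix_(i, j) nth 0 (nth [::] [:: [:: 1; 0; 0]; [:: 0; u; v]; [:: 0; - r'; p']] i) j).
  by rewrite det3E !mxE /= -[RHS]bez; ring.
rewrite /= !mulmx3E !mxE /= m00 m10 m20 -/p -/q -/r -/s.
split; try by ring.
- by rewrite ep er; ring.
- split; first by rewrite mul0r add0r euv.
  rewrite -(pmulr_rgt0 _ Dp); rewrite [X in _ < X](_ : _ = p * s - q * r) //.
  by rewrite ep er; ring.
Qed.

(** * The cubic field *)

Section TotallyRealCubic.
Variables (R : realType) (L : fieldExtType rat) (alpha : L) (a1 a2 a3 : int).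
Variable sigma : 'I_3 -> {rmorphism L -> R}.
Hypothesis F_alpha : root (map_poly (intr : int -> L) (cubic a1 a2 a3)) alpha.
Hypothesis L_gen : <<1; alpha>>%VS = fullv.
Hypothesis Z_max : forall x : L, integralOver (intr : int -> L) x <-> Zalpha alpha x.
Hypothesis sigma_order : 0 < \det (emb_mx sigma (power_basis alpha)).

Local Notation emb := (emb_mx sigma).
Local Notation pb := (power_basis alpha).
Local Notation B0 := (emb_mx sigma (power_basis alpha)).
Implicit Types (b : 'I_3 -> L) (x y z : L) (M N : 'M[int]_3).

Definition act_basis M b : 'I_3 -> L := fun i => \sum_k b k *~ M i k.

Lemma emb_act M b : emb (act_basis M b) = map_mx intr M *m emb b.
Proof.
apply/matrixP => i j; rewrite !mxE rmorph_sum; apply: eq_bigr => k _ /=.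
by rewrite !mxE raddfMz mulrzl.
Qed.

Lemma emb_scale x b :
  emb (fun i => x * b i) = emb b *m diag_mx (\row_j sigma j x).
Proof.
by apply/matrixP => i j; rewrite mul_mx_diag !mxE rmorphM mulrC.
Qed.

(** A field embedding is injective, so identities between triples of field elements can be proved as
    identities of real matrices. *)
Lemma emb_inj b b' : emb b = emb b' -> b =1 b'.
Proof.
move=> /matrixP e i; have := e i o0; rewrite !mxE; exact: fmorph_inj.
Qed.

Lemma act_scale M b x i : act_basis M (fun k => x * b k) i = x * act_basis M b i.
Proof. by rewrite /act_basis mulr_sumr; apply: eq_bigr => k _; rewrite mulrzAr. Qed.

Lemma act_basisM M N b : act_basis M (act_basis N b) =1 act_basis (M *m N) b.
Proof. by apply: emb_inj; rewrite !emb_act map_mxM mulmxA. Qed.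

Lemma act_basis1 b : act_basis 1%:M b =1 b.
Proof. by apply: emb_inj; rewrite emb_act map_mx1 mul1mx. Qed.

Lemma eq_act_basis M b b' : b =1 b' -> act_basis M b =1 act_basis M b'.
Proof. by move=> e i; apply: eq_bigr => k _; rewrite e. Qed.

Lemma B0_unit : B0 \in unitmx.
Proof. by rewrite unitmxE unitfE gt_eqF. Qed.

Lemma alpha_cubic : alpha ^+ 3 = - (a1%:~R * alpha ^+ 2 + a2%:~R * alpha + a3%:~R).
Proof.
move: F_alpha; rewrite /cubic !rmorphD /= !(rmorphM _ (_%:P)) /= !map_polyXn.
rewrite map_polyX !map_polyC /root !hornerE => /eqP h.
by apply/eqP; rewrite -addr_eq0 !addrA h.
Qed.

Lemma alpha_companion : (fun i => alpha * pb i) =1 act_basis (companion a1 a2 a3) pb.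
Proof.
elim/ord3_ind; rewrite /act_basis sum3E !mxE /power_basis /= ?mulr0z ?mulr1z ?addr0 ?add0r.
- by rewrite -exprS alpha_cubic !mulrNz !mulrzl -!opprD expr0 expr1.
- by rewrite expr1 expr2.
- by rewrite expr0 mulr1 expr1.
Qed.

(** The rational span of alpha^2, alpha, 1 contains 1 and is stable under multiplication by alpha,
    so it contains all powers of alpha and hence the field they generate. *)
Lemma rat_coords x : exists c : 'rV[rat]_3, x = \sum_k c 0 k *: pb k.
Proof.
pose S := [set x : L | exists c : 'rV[rat]_3, x = \sum_k c 0 k *: pb k].
have SD y z : S y -> S z -> S (y + z).
  move=> [c ->] [d ->]; exists (c + d); rewrite -big_split; apply: eq_bigr => k _.
  by rewrite mxE scalerDl.
have SZ q y : S y -> S (q *: y).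
  move=> [c ->]; exists (q *: c); rewrite scaler_sumr; apply: eq_bigr => k _.
  by rewrite mxE scalerA.
have Spb i : S (pb i).
  exists (delta_mx 0 i); rewrite (bigD1 i) //= mxE !eqxx scale1r big1 ?addr0 // => k ki.
  by rewrite mxE (negbTE ki) scale0r.
have Sint (M : 'M[int]_3) i : S (act_basis M pb i).
  by rewrite /act_basis sum3E -!scaler_int; apply: (SD); [apply: (SD)|]; apply: (SZ).
have Sa y : S y -> S (alpha * y).
  move=> [c ->]; rewrite mulr_sumr sum3E.
  by apply: (SD); [apply: (SD)|]; rewrite -scalerAr alpha_companion; apply: (SZ).
have SX n : S (alpha ^+ n).
  elim: n => [|n IH]; first by have := Spb o2; rewrite /power_basis subnn expr0.
  by rewrite exprS; apply: Sa.
have : x \in <<1; alpha>>%VS by rewrite L_gen memvf.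
move/Fadjoin_polyP => [p /polyOverP p1 ->]; rewrite horner_coef.
elim/big_ind: _ => [|//|i _].
- exists 0; rewrite big1 // => k _; by rewrite mxE scale0r.
- have /vlineP[q ->] := p1 i; rewrite mulr_algl; exact: SZ.
Qed.

(* The alpha^2-coefficient of x, computed in R from the conjugates of x; v is
   the first column of B0^-1. *)
Let v : 'cV[R]_3 := invmx B0 *m delta_mx o0 0.
Definition lead_coord x : R := \sum_j sigma j x * v j 0.
Local Notation tau := lead_coord.

Lemma lead_coord_pb i : tau (pb i) = (i == o0)%:R.
Proof.
transitivity ((B0 *m v) i 0); first by rewrite mxE; apply: eq_bigr => j _; rewrite !mxE.
by rewrite /v mulKVmx ?B0_unit // mxE andbT.
Qed.

Lemma lead_coordD x y : tau (x + y) = tau x + tau y.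
Proof. by rewrite /tau -big_split; apply: eq_bigr => j _; rewrite rmorphD mulrDl. Qed.

Lemma lead_coordZ (q : rat) x : tau (q *: x) = ratr q * tau x.
Proof. by rewrite /tau mulr_sumr; apply: eq_bigr => j _; rewrite rmorphZ_num mulrA. Qed.

Lemma lead_coord_rat (c : 'I_3 -> rat) : tau (\sum_k c k *: pb k) = ratr (c o0).
Proof.
rewrite sum3E !lead_coordD !lead_coordZ !lead_coord_pb !eqxx.
by rewrite mulr1 !mulr0 !addr0.
Qed.

(** This is Euler's formula v_j = 1 / F'(alpha^(j)). The functional sum_j v_j f(x_j) takes the
    values 1, 0, 0 at X^2, X, 1; applied to f = (X - x1)(X - x2) it gives (x0 - x1)(x0 - x2) v_0 =
    1, and likewise for the other indices. *)
Lemma dual_vec_neq0 j : v j 0 != 0.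
Proof.
have h0 : tau (pb o0) = 1 by rewrite lead_coord_pb.
have h1 : tau (pb o1) = 0 by rewrite lead_coord_pb.
have h2 : tau (pb o2) = 0 by rewrite lead_coord_pb.
move: h0 h1 h2; rewrite /tau !sum3E /power_basis /= !expr0 !expr1 !rmorph1 !mul1r !rmorphXn /=.
move: (sigma o0 alpha) (sigma o1 alpha) (sigma o2 alpha) => x0 x1 x2 h0 h1 h2.
suff [e0 e1 e2] : [/\ (x0 - x1) * (x0 - x2) * v o0 0 = 1,
    (x1 - x0) * (x1 - x2) * v o1 0 = 1 & (x2 - x0) * (x2 - x1) * v o2 0 = 1].
  have n0 (a w : R) : a * w = 1 -> w != 0.
    by move=> e; apply: contra_eq_neq e => ->; rewrite mulr0 eq_sym oner_neq0.
  by elim/ord3_ind: j; [exact: n0 e0|exact: n0 e1|exact: n0 e2].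
split.
- rewrite -[RHS]subr0 -[X in _ = _ - X](mulr0 (x1 + x2)) -h0 -h1.
  by rewrite -[LHS]addr0 -[X in _ + X = _](mulr0 (- (x1 * x2))) -h2; ring.
- rewrite -[RHS]subr0 -[X in _ = _ - X](mulr0 (x0 + x2)) -h0 -h1.
  by rewrite -[LHS]addr0 -[X in _ + X = _](mulr0 (- (x0 * x2))) -h2; ring.
- rewrite -[RHS]subr0 -[X in _ = _ - X](mulr0 (x0 + x1)) -h0 -h1.
  by rewrite -[LHS]addr0 -[X in _ + X = _](mulr0 (- (x0 * x1))) -h2; ring.
Qed.

Lemma sum_act_basis M b (c : 'I_3 -> int) :
  \sum_k act_basis M b k *~ c k = \sum_j b j *~ (\sum_k c k * M k j).
Proof.
under eq_bigr do rewrite /act_basis mulrz_suml.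
rewrite exchange_big; apply: eq_bigr => j _; rewrite mulrz_sumr.
by apply: eq_bigr => k _; rewrite -mulrzA mulrC.
Qed.

Lemma ZalphaB x y : Zalpha alpha x -> Zalpha alpha y -> Zalpha alpha (x - y).
Proof. by move=> [p ->] [q ->]; exists (p - q); rewrite rmorphB hornerD hornerN. Qed.

Lemma ZalphaM x y : Zalpha alpha x -> Zalpha alpha y -> Zalpha alpha (x * y).
Proof. by move=> [p ->] [q ->]; exists (p * q); rewrite rmorphM hornerM. Qed.

Lemma Zalpha_int (n : int) : Zalpha alpha n%:~R.
Proof. by exists n%:P; rewrite map_polyC hornerC. Qed.

Lemma Zalpha_alpha : Zalpha alpha alpha.
Proof. by exists 'X; rewrite map_polyX hornerX. Qed.

Lemma Zalpha_comb x :
  Zalpha alpha x <-> exists c : 'I_3 -> int, x = \sum_k pb k *~ c k.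
Proof.
split=> [[p ->]|[c ->]]; last first.
  have ZD y z : Zalpha alpha y -> Zalpha alpha z -> Zalpha alpha (y + z).
    move=> hy hz; rewrite -(opprK z) -[- z]add0r; apply: ZalphaB => //.
    by apply: ZalphaB => //; apply: (Zalpha_int 0).
  have Zpb k : Zalpha alpha (pb k).
    rewrite /power_basis; elim: (2 - k)%N => [|n IH]; first exact: (Zalpha_int 1).
    by rewrite exprS; apply: ZalphaM => //; apply: Zalpha_alpha.
  elim/big_ind: _ => [|//|k _]; first exact: (Zalpha_int 0).
  by rewrite -mulrzr; apply: ZalphaM => //; apply: Zalpha_int.
elim/poly_ind: p => [|p n [c IH]].
  by exists (fun=> 0); rewrite rmorph0 horner0 big1.
rewrite rmorphD rmorphM /= map_polyX map_polyC /= hornerMXaddC IH mulrC mulr_sumr.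
under eq_bigr => k _ do rewrite mulrzAr alpha_companion.
rewrite sum_act_basis.
exists (fun k => \sum_i c i * companion a1 a2 a3 i k + n *+ (k == o2)).
under [RHS]eq_bigr do rewrite mulrzDr.
rewrite big_split; congr (_ + _).
by rewrite sum3E /power_basis /= mulr0n mulr1n !mulr0z !add0r.
Qed.

Lemma ratr_int_inj (q : rat) (n : int) : ratr q = n%:~R :> R -> q = n%:~R.
Proof. by rewrite -(ratr_int R n) => /fmorph_inj. Qed.

Lemma lead_coord_Zalpha x : Zalpha alpha x -> exists n : int, tau x = n%:~R.
Proof.
move=> /Zalpha_comb[c ->]; exists (c o0).
under eq_bigr => k _ do rewrite -scaler_int.
by rewrite (lead_coord_rat (fun k => (c k)%:~R)) ratr_int.
Qed.

(** Self-duality of Z[alpha] under the [lead_coord] of a product. The values for n = 0, 1, 2 already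
    determine the coordinates by an integral unitriangular system. *)
Lemma Zalpha_lead_coord x :
  (forall n, exists z : int, tau (alpha ^+ n * x) = z%:~R) -> Zalpha alpha x.
Proof.
have [c ->] := rat_coords x => h.
have := h 0; have := h 1%N; have := h 2.
pose A := map_mx intr (companion a1 a2 a3) : 'M[rat]_3.
have step (d : 'rV[rat]_3) : alpha * (\sum_k d 0 k *: pb k) = \sum_k (d *m A) 0 k *: pb k.
  rewrite mulr_sumr; under eq_bigr => k _ do rewrite -scalerAr alpha_companion scaler_sumr.
  rewrite exchange_big; apply: eq_bigr => j _; rewrite mxE scaler_suml.
  by apply: eq_bigr => k _; rewrite !mxE -scaler_int scalerA.
rewrite expr2 -mulrA !expr1 expr0 mul1r !step.
rewrite !(lead_coord_rat (fun k => (_ : 'rV_3) 0 k)) !mulmx3E !mxE /=.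
rewrite !(mulr0, mulr1, addr0).
move=> [n2 /ratr_int_inj e2] [n1 /ratr_int_inj e1] [n0 /ratr_int_inj e0].
apply/Zalpha_comb.
(* Solves n0 = c0, n1 = c1 - a1 c0, n2 = c2 - a2 c0 - a1 n1 for the coordinates c0, c1, c2 of x. *)
pose n k := nth 0 [:: n0; n1 + a1 * n0; n2 + a1 * n1 + a2 * n0] k.
exists (fun k => n (val k)); apply: eq_bigr => k _; rewrite -scaler_int.
congr (_ *: _); elim/ord3_ind: k => //=.
- by rewrite !rmorphD rmorphM /= -e0 -e1 rmorphN; ring.
- by rewrite !rmorphD !rmorphM /= -e0 -e1 -e2 !rmorphN; ring.
Qed.

(** Here u is an eigenvalue of an integer matrix with eigenvector b, hence a root of its monic
    characteristic polynomial; maximality puts u in Z[alpha]. *)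
Lemma multiplier_Zalpha u M b i0 :
  b i0 != 0 -> (fun i => u * b i) =1 act_basis M b -> Zalpha alpha u.
Proof.
move=> b0 e; apply/Z_max; exists (char_poly M^T); first exact: char_poly_monic.
rewrite map_char_poly -eigenvalue_root_char; apply/eigenvalueP.
exists (\row_k b k).
  apply/rowP => i; rewrite !mxE e /act_basis; apply: eq_bigr => k _.
  by rewrite !mxE mulrzr.
by apply: contra_neq b0 => /rowP/(_ i0); rewrite !mxE.
Qed.

Lemma lead_coordMz x (n : int) : tau (x *~ n) = n%:~R * tau x.
Proof. by rewrite -scaler_int lead_coordZ ratr_int. Qed.

(** Lets [multiplier_Zalpha] apply to any root of a monic integer cubic, with y^2, y, 1 as the
    stable triple. *)
Lemma act_companion y (b := power_basis y) (c1 c2 c3 : int) :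
  y ^+ 3 + c1%:~R * y ^+ 2 + c2%:~R * y + c3%:~R = 0 ->
  (fun i => y * b i) =1 act_basis (companion c1 c2 c3) b.
Proof.
move=> e; elim/ord3_ind;
  rewrite /act_basis sum3E !mxE /b /power_basis /= ?mulr0z ?mulr1z ?addr0 ?add0r.
- rewrite -exprS -[_ *~ _]mulrzr -[X in _ + X + _]mulrzr -[X in _ + X]mulrzr !rmorphN /=.
  apply/eqP; rewrite -subr_eq0 -e; apply/eqP; ring.
- by rewrite expr1 expr2.
- by rewrite expr0 mulr1 expr1.
Qed.

(* Dedekind's criterion: if p divides m1, m2 and mu1 - mu2, then x = alpha - mu1
   satisfies x^3 + A x^2 + p B x + p^2 C = 0, so that y = p C / x is a root of
   y^3 + B y^2 + A C y + p C^2 and hence integral, while its alpha^2-coefficient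
   is -1/p. *)
Lemma ideal_cond_coprime m1 m2 mu1 mu2 lam : 0 < m1 -> 0 < m2 ->
  ideal_cond a1 a2 a3 m1 m2 mu1 mu2 lam -> gcdz (gcdz m1 m2) (mu1 - mu2) = 1.
Proof.
move=> m1p m2p [k [q [r [h1 h2 h3]]]].
have p0 : gcdz (gcdz m1 m2) (mu1 - mu2) != 0.
  by rewrite !gcdz_eq0 (gt_eqF m1p).
have pp : 0 < gcdz (gcdz m1 m2) (mu1 - mu2) by rewrite lt_def p0.
have /dvdzP[n1 e1] := dvdz_trans (dvdz_gcdl (gcdz m1 m2) (mu1 - mu2)) (dvdz_gcdl m1 m2).
have /dvdzP[n2 e2] := dvdz_trans (dvdz_gcdl (gcdz m1 m2) (mu1 - mu2)) (dvdz_gcdr m1 m2).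
have /dvdzP[e e3] := dvdz_gcdr (gcdz m1 m2) (mu1 - mu2).
move: (gcdz _ _) p0 pp e1 e2 e3 => p p0 pp e1 e2 e3.
have {}e3 : mu2 = mu1 - e * p by rewrite -e3; ring.
(* Taylor coefficients of F at mu1: A = F''(mu1) / 2, p B = F'(mu1) and p^2 C = F(mu1). *)
pose A := 3 * mu1 + a1.
pose B := n2 * q - n1 * k + 3 * e * mu1 - p * e ^+ 2 + a1 * e.
pose C := n1 * n2 * r - n1 * k * e.
have eB : p * B = 3 * mu1 ^+ 2 + 2 * a1 * mu1 + a2.
  transitivity (m2 * q - m1 * k + p * (3 * e * mu1 - p * e ^+ 2 + a1 * e)).
    by rewrite /B e1 e2; ring.
  by rewrite -h2 h1 e3; ring.
have eC : p ^+ 2 * C = mu1 ^+ 3 + a1 * mu1 ^+ 2 + a2 * mu1 + a3.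
  rewrite -cubicE; transitivity (m1 * m2 * r - m1 * k * (e * p)).
    by rewrite /C e1 e2; ring.
  by rewrite -h3 e3; ring.
pose c (n : int) : L := n%:~R.
pose x := alpha - c mu1.
have ex : x ^+ 3 + c A * x ^+ 2 + c p * c B * x + c p ^+ 2 * c C = 0.
  have -> : c p * c B = 3 * c mu1 ^+ 2 + 2 * c a1 * c mu1 + c a2.
    by rewrite /c -rmorphM eB; ring.
  have -> : c p ^+ 2 * c C = c mu1 ^+ 3 + c a1 * c mu1 ^+ 2 + c a2 * c mu1 + c a3.
    by rewrite /c -rmorphXn -rmorphM eC; ring.
  have -> : c A = 3 * c mu1 + c a1 by rewrite /c /A; ring.
  transitivity (alpha ^+ 3 + c a1 * alpha ^+ 2 + c a2 * alpha + c a3).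
    by rewrite /x; ring.
  by rewrite alpha_cubic /c; ring.
have x0 : x != 0.
  apply: contraTneq (@ltr01 R) => x0.
  have : tau (alpha * x) = 1.
    have -> : alpha * x = pb o0 + pb o1 *~ (- mu1).
      by rewrite /x /power_basis /= expr1 mulrNz -mulrzr; ring.
    by rewrite lead_coordD lead_coordMz !lead_coord_pb mulr0 addr0.
  rewrite x0 mulr0 => <-; rewrite /tau big1 ?ltxx // => j _.
  by rewrite rmorph0 mul0r.
have cp0 : c p != 0.
  apply: contra_neq p0 => h; apply/eqP; rewrite -(intr_eq0 R); apply/eqP.
  by rewrite -(rmorph_int (sigma o0)) -/(c p) h rmorph0.
(* This equals p C / x, written without dividing by x so that the alpha^2-coefficient can be read
   off. *)
pose y := - ((x ^+ 2 + c A * x + c p * c B) / c p).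
have ey : y ^+ 3 + B%:~R * y ^+ 2 + (A * C)%:~R * y + (p * C ^+ 2)%:~R = 0.
  have yx : y * x = c p * c C.
    apply: (mulfI cp0); transitivity (- ((x ^+ 2 + c A * x + c p * c B) * x)).
      by rewrite /y; move: (c p) cp0 => w w0; field.
    by apply/eqP; rewrite -subr_eq0 -oppr_eq0; apply/eqP; rewrite -[RHS]ex; ring.
  apply: (mulIf (expf_neq0 3 x0)); rewrite mul0r.
  transitivity ((y * x) ^+ 3 + c B * (y * x) ^+ 2 * x + c A * c C * (y * x) * x ^+ 2
     + c p * c C ^+ 2 * x ^+ 3); first by rewrite /c; ring.
  rewrite yx.
  transitivity (c p * c C ^+ 2 *
    (x ^+ 3 + c A * x ^+ 2 + c p * c B * x + c p ^+ 2 * c C)); first by ring.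
  by rewrite ex mulr0.
have Zy : Zalpha alpha y.
  apply: (@multiplier_Zalpha _ _ _ o2 _ (act_companion ey)).
  by rewrite /power_basis expr0 oner_neq0.
have [n hn] := lead_coord_Zalpha Zy.
have : tau (y *~ (- p)) = 1.
  have -> : y *~ (- p) = pb o0 + pb o1 *~ (A - 2 * mu1)
       + pb o2 *~ (mu1 ^+ 2 - A * mu1 + p * B).
    transitivity (x ^+ 2 + c A * x + c p * c B).
      have cN : (- p)%:~R = - c p by rewrite /c rmorphN.
      by rewrite -mulrzr cN /y; move: (c p) cp0 => w w0; field.
    rewrite /power_basis /= expr0 expr1 -[X in _ = _ + X + _]mulrzr.
    rewrite -[X in _ = _ + X]mulrzr.
    by rewrite /x /c; ring.
  by rewrite !lead_coordD !lead_coordMz !lead_coord_pb !mulr0 !addr0.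
rewrite lead_coordMz hn -rmorphM -[1]/(1%:~R) => /intr_inj h.
have n0 : 0 < - n by rewrite -(pmulr_rgt0 _ pp) mulrN -mulNr h.
by move: pp h n0; clear; nia.
Qed.

(** * Bases of fractional ideals, determinants and orientation *)

Lemma Zbasis_mem b (I : set L) M i : Zbasis b I -> I (act_basis M b i).
Proof. by move=> [h _]; apply/h; exists (M i). Qed.

Lemma Zbasis_act b b' (I : set L) : Zbasis b I -> (forall i, I (b' i)) ->
  exists M, b' =1 act_basis M b.
Proof.
move=> [h _] hb; have hc i := (h _).1 (hb i).
have [c ec] := choice hc.
exists (\matrix_(i, k) c i k) => i; rewrite ec; apply: eq_bigr => k _.
by rewrite mxE.
Qed.

Lemma basis_neq0 b i : \det (emb b) != 0 -> b i != 0.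
Proof.
rewrite -unitfE -unitmxE => U; apply: contraTneq (@ltr01 R) => bi.
have : delta_mx 0 i *m emb b = 0 :> 'rV_3.
  by rewrite -rowE; apply/rowP => j; rewrite !mxE bi rmorph0.
move/(congr1 (fun w : 'rV[R]_3 => (w *m invmx (emb b)) 0 i)); rewrite mulmxK // mul0mx !mxE !eqxx.
by move/eqP; rewrite oner_eq0.
Qed.

Lemma det_emb_scale x b : \det (emb (fun i => x * b i)) = normK sigma x * \det (emb b).
Proof.
rewrite emb_scale det_mulmx det_diag mulrC; congr (_ * _).
by apply: eq_bigr => j _; rewrite mxE.
Qed.

Lemma normK_neq0 x : x != 0 -> normK sigma x != 0.
Proof. by move=> x0; apply/prodf_neq0 => j _; rewrite fmorph_eq0. Qed.

Lemma det_emb_act M b : \det (emb (act_basis M b)) = (\det M)%:~R * \det (emb b).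
Proof. by rewrite emb_act det_mulmx det_map_mx. Qed.

Lemma Zalpha_pb i : Zalpha alpha (pb i).
Proof.
apply/Zalpha_comb; exists (fun k => (k == i)%:R).
by rewrite (bigD1 i) //= eqxx mulr1z big1 ?addr0 // => k /negbTE ->; rewrite mulr0z.
Qed.

(** A nonzero x in I gives x alpha^2, x alpha, x, a triple of nonzero determinant that is an integer
    combination of b. *)
Lemma Zbasis_det_neq0 b (I : set L) : frac_ideal alpha I -> Zbasis b I -> \det (emb b) != 0.
Proof.
move=> [_ IM [x Ix x0] _] bI.
have [N eN] : exists N, (fun i => x * pb i) =1 act_basis N b.
  by apply: Zbasis_act bI _ => i; rewrite mulrC; apply: IM => //; apply: Zalpha_pb.
have : \det (emb (fun i => x * pb i)) != 0.
  by rewrite det_emb_scale mulf_neq0 ?normK_neq0 // gt_eqF.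
rewrite (_ : emb (fun i => x * pb i) = emb (act_basis N b)); last first.
  by apply/matrixP => i j; rewrite !mxE eN.
by rewrite det_emb_act mulf_eq0 negb_or => /andP[].
Qed.

Lemma emb_ext b b' : b =1 b' -> emb b = emb b'.
Proof. by move=> e; apply/matrixP => i j; rewrite !mxE e. Qed.

Lemma int_mx_inj : injective (map_mx (intr : int -> R) : 'M_3 -> 'M_3).
Proof.
move=> M N /matrixP e; apply/matrixP => i j; have := e i j; rewrite !mxE.
exact: intr_inj.
Qed.

Lemma act_basis_inj b M N :
  \det (emb b) != 0 -> act_basis M b =1 act_basis N b -> M = N.
Proof.
rewrite -unitfE -unitmxE => U /emb_ext; rewrite !emb_act => /(can_inj (mulmxK U)).
exact: int_mx_inj.
Qed.

(** Inverse integer matrices have determinant 1 or -1, and equal orientations select 1. *)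
Lemma change_basis_det b b' M N : 0 < \det (emb b) -> 0 < \det (emb b') ->
  b' =1 act_basis M b -> b =1 act_basis N b' -> \det M = 1 /\ N *m M = 1%:M.
Proof.
move=> dp dp' e e'.
have NM : N *m M = 1%:M.
  apply: (@act_basis_inj b); first by rewrite gt_eqF.
  move=> i; rewrite -act_basisM act_basis1 (e' i); apply: eq_act_basis => k.
  by rewrite e.
split=> //; have Mp : 0 < \det M.
  by rewrite -(ltr0z R) -(pmulr_lgt0 _ dp) -det_emb_act -(emb_ext e).
have mn : \det M * \det N = 1 by rewrite mulrC -det_mulmx NM det1.
have Np : 0 < \det N by rewrite -(pmulr_rgt0 _ Mp) mn.
by move: (\det M) (\det N) Mp Np mn; clear; nia.
Qed.

Lemma atilde_torus x : totpos sigma x ->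
  exists2 c : R, 0 < c & atilde sigma x = c *: diag_mx (\row_j sigma j x) /\
    torus (atilde sigma x).
Proof.
move=> xp; have Np : 0 < normK sigma x by apply: prodr_gt0 => j _; apply: xp.
exists (normK sigma x `^ (- 3^-1)); first exact: powR_gt0.
split=> //; apply/torusP.
exists (\row_j (normK sigma x `^ (- 3^-1) * sigma j x)); split.
- apply/matrixP => i j; rewrite !mxE mulrnAr; case: eqP => [->|_] //.
- by move=> j; rewrite mxE mulr_gt0 ?powR_gt0.
- rewrite (eq_bigr (fun j => normK sigma x `^ (- 3^-1) * sigma j x)); last first.
    by move=> j _; rewrite mxE.
  rewrite big_split prodr_const card_ord /= -/(normK sigma x) -powR_mulrn ?powR_ge0 //.
  by rewrite -powRrM mulNr mulVf ?pnatr_eq0 // powR_inv1 ?ltW // mulVf ?gt_eqF.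
Qed.

Lemma rescale_mulGamma M (B : 'M[R]_3) : \det M = 1 ->
  rescale (map_mx intr M *m B) = map_mx intr M *m rescale B.
Proof.
by move=> dM; rewrite /rescale det_mulmx det_map_mx dM mul1r scalemxAr.
Qed.

(** * Points of the torus orbits *)

Definition A_rep b x : 'M[R]_3 :=
  rescale (emb b) *m atilde sigma x *m invmx (rescale B0).

Lemma A_rep_det1 b x : 0 < \det (emb b) -> totpos sigma x -> \det (A_rep b x) = 1.
Proof.
move=> dp /atilde_torus[_ _ [_ /torus_det d1]]; rewrite !det_mulmx det_inv d1.
have [_ _ [_ ->]] := rescale_pos dp; have [_ _ [_ ->]] := rescale_pos sigma_order.
by rewrite invr1 !mulr1.
Qed.

Lemma A_rep_act b x M : 0 < \det (emb b) -> totpos sigma x ->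
  (fun i => x * b i) =1 act_basis M pb ->
  exists2 c : R, 0 < c & A_rep b x = c *: map_mx intr M.
Proof.
move=> dp /atilde_torus[c2 c2p [ea _]] e; rewrite /A_rep ea.
have [c1 c1p [-> _]] := rescale_pos dp; have [c0 c0p [-> _]] := rescale_pos sigma_order.
exists (c1 * c2 / c0); first by rewrite divr_gt0 ?mulr_gt0.
rewrite invmxZ; last by rewrite unitmxZ ?B0_unit // unitfE gt_eqF.
rewrite -!scalemxAl -!scalemxAr -!scalemxAl !scalerA -emb_scale (emb_ext e) emb_act.
rewrite mulmxK ?B0_unit //; congr (_ *: _); move: (c0^-1) => d; ring.
Qed.

Lemma A_rep_Gamma M b x : \det M = 1 ->
  A_rep (act_basis M b) x = map_mx intr M *m A_rep b x.
Proof. by move=> dM; rewrite /A_rep emb_act rescale_mulGamma // !mulmxA. Qed.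

Lemma p_mx_P0 m1 m2 mu1 mu2 lam : 0 < m2 -> P0 (p_mx R a1 m1 m2 mu1 mu2 lam).
Proof.
move=> m2p; have sp : 0 < Num.sqrt (m2%:~R : R) by rewrite sqrtr_gt0 ltr0z.
split.
  rewrite /p_mx det_mulmx !det3E !mxE /= !(mulr0, mul0r, subr0, mul1r, mulr1, addr0).
  by rewrite mulVf ?gt_eqF.
apply/matrixP; elim/ord3_ind => j; rewrite (ord1 j) !mxE sum3E !mxE /=;
  by rewrite !(mulr0, mul0r, mulr1, addr0).
Qed.

Lemma expR_horo_time m1 m2 : 0 < m1 -> 0 < m2 ->
  expR (6 * horo_time R m1 m2) = (m1 ^+ 2 * m2)%:~R.
Proof.
move=> m1p m2p; rewrite /horo_time mulrA divff ?mul1r ?pnatr_eq0 // lnK // posrE ltr0z.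
by rewrite mulr_gt0 ?exprn_gt0.
Qed.

(** The scalar is read off the first column. Since exp(6t) = m1^2 m2, also exp(t) = m1 sqrt(m2)
    exp(-2t), which clears the denominators of the other two columns. *)
Lemma p_mx_ideal_mx m1 m2 mu1 mu2 lam : 0 < m1 -> 0 < m2 ->
  p_mx R a1 m1 m2 mu1 mu2 lam *m a_ (horo_time R m1 m2) =
    expR (- 2 * horo_time R m1 m2) *: map_mx intr (ideal_mx a1 m1 m2 mu1 mu2 lam).
Proof.
move=> m1p m2p; set t := horo_time R m1 m2; set s := Num.sqrt (m2%:~R : R).
have M1 : 0 < m1%:~R :> R by rewrite ltr0z.
have M2 : 0 < m2%:~R :> R by rewrite ltr0z.
have sp : 0 < s by rewrite sqrtr_gt0.
have s2 : s ^+ 2 = m2%:~R by rewrite sqr_sqrtr // ltW.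
have e3 : expR t ^+ 3 = m1%:~R * s.
  apply: (pexpIrn (isT : (0 < 2)%N)); rewrite ?nnegrE ?exprn_ge0 ?expR_ge0 //.
    by rewrite mulr_ge0 ?ltW.
  rewrite /= -exprM -expRM_natl expR_horo_time // exprMn s2 rmorphM rmorphXn //.
pose w := expR (- 2 * t).
have e2 : w = (expR t ^+ 2)^-1 by rewrite /w mulNr expRN expRM_natl.
have et : expR t = m1%:~R * s * w.
  by rewrite -e3 e2 exprSr mulrAC mulfV ?mul1r // gt_eqF ?exprn_gt0 ?expR_gt0.
have s0 : s != 0 by rewrite gt_eqF.
have n0 : m1%:~R != 0 :> R by rewrite gt_eqF.
rewrite /p_mx /a_ -mulmxA mul_diag3 -/t -/w -/s et.
apply/matrixP; elim/ord3_ind; elim/ord3_ind;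
  rewrite mulmx3E !mxE /= !(mulr0, mul0r, addr0, add0r, mul1r, mulr1) //;
  rewrite ?rmorphN ?rmorphM /= -?s2; move: s (m1%:~R) w s0 n0 {s2 e2 e3 et sp M1} => s n w s0 n0;
  by field; rewrite ?s0 ?n0.
Qed.

Lemma col0_P0_a (p : 'M[R]_3) t : P0 p ->
  p *m a_ t *m delta_mx o0 0 = expR (- 2 * t) *: delta_mx o0 0 :> 'cV_3.
Proof.
move=> [_ /colP p0].
have e i : p i o0 = (i == o0)%:R.
  have := p0 i; rewrite !mxE andbT (_ : (0 : 'I_3) = o0); first by move=> ->.
  exact: val_inj.
apply/colP => i; rewrite mulmx3E !mulmx3E !mxE /= !(mulr0, mul0r, addr0, mulr1) e ?andbT.
by rewrite mulrC ?andbT.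
Qed.

(** The first columns are exp(-2t) and exp(-2t') times the first unit vector, and their ratio is a
    positive entry of an integer matrix, hence at least 1. Exchanging the points gives the other
    inequality. *)
Lemma horo_coset_time (p p' : 'M[R]_3) t t' : P0 p -> P0 p' ->
  coset_pt (@Gamma R) (p *m a_ t) = coset_pt (@Gamma R) (p' *m a_ t') -> t = t'.
Proof.
have le (q q' : 'M[R]_3) s s' : P0 q -> P0 q' ->
    coset_pt (@Gamma R) (q *m a_ s) = coset_pt (@Gamma R) (q' *m a_ s') -> s <= s'.
  move=> Pq Pq' /(coset_ptP _ _ (Gamma_group R))[_ [g dg <-] e].
  have := congr1 (fun M : 'M_3 => (M *m delta_mx o0 0 : 'cV_3) o0 0) e.
  rewrite col0_P0_a // -(mulmxA (map_mx _ g)) col0_P0_a // -scalemxAr.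
  rewrite !mxE sum3E !mxE /= !(mulr0, mulr1, addr0) => h.
  have gp : 0 < g o0 o0.
    by rewrite -(ltr0z R) -(pmulr_rgt0 _ (expR_gt0 (- 2 * s'))) -h expR_gt0.
  have : expR (- 2 * s') <= expR (- 2 * s).
    by rewrite h ler_peMr ?expR_ge0 // ler1z.
  by rewrite ler_expR; lra.
move=> Pp Pp' e; apply/eqP; rewrite eq_le (le _ _ _ _ Pp Pp' e).
by rewrite (le _ _ _ _ Pp' Pp (esym e)).
Qed.

Lemma matched_points b x g m1 m2 mu1 mu2 lam :
  0 < \det (emb b) -> totpos sigma x -> \det g = 1 -> 0 < m1 -> 0 < m2 ->
  (fun i => x * act_basis g b i) =1 act_basis (ideal_mx a1 m1 m2 mu1 mu2 lam) pb ->
  coset_pt (@Gamma R) (A_rep b x) =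
    coset_pt (@Gamma R) (p_mx R a1 m1 m2 mu1 mu2 lam *m a_ (horo_time R m1 m2)) /\
  normK sigma x * ideal_norm alpha sigma b = (m1 ^+ 2 * m2)%:~R.
Proof.
move=> dp xp dg m1p m2p e.
have dp' : 0 < \det (emb (act_basis g b)) by rewrite det_emb_act dg mul1r.
split.
  apply: esym; apply/(coset_ptP _ _ (Gamma_group R)).
  exists (map_mx intr g); first by exists g.
  rewrite -A_rep_Gamma //; have d1 := A_rep_det1 dp' xp.
  have [c cp eA] := A_rep_act dp' xp e.
  have eP := p_mx_ideal_mx mu1 mu2 lam m1p m2p.
  apply: (det1_proportional_eq d1 (k := expR (- 2 * horo_time R m1 m2) / c)).
    by rewrite det_mulmx (torus_det (a_torus _)) mulr1; case: (p_mx_P0 m1 mu1 mu2 lam m2p).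
  by rewrite eP eA scalerA divfK // gt_eqF.
have := congr1 determinant (emb_ext e).
rewrite det_emb_scale !det_emb_act dg mul1r det_ideal_mx => h.
by rewrite /ideal_norm !gtr0_norm // mulrA h mulfK // gt_eqF.
Qed.

Lemma ideal_pb_act M : (fun i => alpha * act_basis M pb i) =1
  act_basis (M *m companion a1 a2 a3) pb.
Proof.
move=> i; rewrite -act_scale -act_basisM; apply: eq_act_basis; exact: alpha_companion.
Qed.

(** * Totally positive units and the stabilisers in the torus *)

Lemma units_act b (I : set L) u : Zbasis b I -> frac_ideal alpha I -> 0 < \det (emb b) ->
  units_pos alpha sigma u ->
  normK sigma u = 1 /\ exists2 g, \det g = 1 & (fun i => u * b i) =1 act_basis g b.
Proof.
move=> bI [_ IM _ _] dp [Zu Zu' up].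
have Ib i : I (b i) by rewrite -(act_basis1 b i); apply: Zbasis_mem.
have [g eg] : exists g, (fun i => u * b i) =1 act_basis g b.
  by apply: Zbasis_act bI _ => i; apply: IM.
have [g' eg'] : exists g, (fun i => u^-1 * b i) =1 act_basis g b.
  by apply: Zbasis_act bI _ => i; apply: IM.
have Np : 0 < normK sigma u by apply: prodr_gt0 => j _; apply: up.
have dp' : 0 < \det (emb (fun i => u * b i)) by rewrite det_emb_scale mulr_gt0.
have u0 : u != 0.
  by apply: contraTneq (up o0) => ->; rewrite rmorph0 ltxx.
have eb : b =1 act_basis g' (fun i => u * b i).
  by move=> i; rewrite act_scale -eg' mulrA mulfV // mul1r.
have [dg _] := change_basis_det dp dp' eg eb.
split; last by exists g.
have := congr1 determinant (emb_ext eg); rewrite det_emb_scale det_emb_act dg.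
by move/(mulIf (lt0r_neq0 dp)).
Qed.

Lemma atilde_norm1 x : normK sigma x = 1 -> atilde sigma x = diag_mx (\row_j sigma j x).
Proof. by move=> e; rewrite /atilde e powR1 scale1r. Qed.

(** A diagonal matrix in the stabiliser acts on the basis as an integer matrix g, so its entries are
    the conjugates of the ratio u of first basis elements after and before g. Then u and its inverse
    act on the basis through g and its inverse, and are integral. *)
Lemma stab_units b (I : set L) (m : 'M[R]_3) : Zbasis b I -> frac_ideal alpha I ->
  0 < \det (emb b) ->
  stab (rescale (emb b)) m <-> exists2 u, units_pos alpha sigma u & m = atilde sigma u.
Proof.
move=> bI II dp; have U : emb b \in unitmx by rewrite unitmxE unitfE gt_eqF.
have [c cp [ec dc]] := rescale_pos dp; have U' := mx3_unit_det1 dc.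
split=> [[[_ [g dg <-] eg] /torusP[d [ed dpos d1]]]|[u Uu ->]]; last first.
  have [Nu [g dg eg]] := units_act bI II dp Uu.
  have [_ _ up] := Uu; have [_ _ [_ At]] := atilde_torus up.
  split=> //; exists (map_mx intr g); first by exists g.
  apply: (can_inj (mulKmx U')); rewrite -!mulmxA mulKVmx // atilde_norm1 //.
  by rewrite ec -scalemxAl -scalemxAr -emb_scale (emb_ext eg) emb_act.
have {}eg : emb b *m diag_mx d = emb (act_basis g b).
  have c0 : c != 0 by rewrite gt_eqF.
  apply: (scalerI c0); rewrite emb_act scalemxAl -ec scalemxAr -ec -ed -eg.
  by rewrite -!mulmxA mulKVmx.
have b0 := basis_neq0 o0 (lt0r_neq0 dp).
pose u := act_basis g b o0 / b o0.
have su j : sigma j u = d 0 j.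
  have /matrixP/(_ o0 j) := eg; rewrite mul_mx_diag !mxE => h.
  by rewrite /u fmorph_div -h mulrAC mulfV ?mul1r // fmorph_eq0.
have eu : (fun i => u * b i) =1 act_basis g b.
  apply: emb_inj; rewrite -eg emb_scale; congr (_ *m diag_mx _).
  by apply/rowP => j; rewrite mxE su.
have eu' : (fun i => u^-1 * b i) =1 act_basis (invmx g) b.
  move=> i; have u0 : u != 0 by rewrite -(fmorph_eq0 (sigma o0)) su gt_eqF.
  apply: (mulfI u0); rewrite mulVKf // -act_scale (eq_act_basis _ eu) act_basisM.
  by rewrite mulVmx ?act_basis1 // mx3_unit_det1.
have N1 : normK sigma u = 1.
  by rewrite -d1; apply: eq_bigr => j _; rewrite su.
exists u.
  split; [exact: multiplier_Zalpha b0 eu|exact: multiplier_Zalpha b0 eu'|].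
  by move=> j; rewrite su.
by rewrite ed atilde_norm1 //; congr diag_mx; apply/rowP => j; rewrite mxE su.
Qed.

Lemma normKM x y : normK sigma (x * y) = normK sigma x * normK sigma y.
Proof. by rewrite -big_split; apply: eq_bigr => j _; rewrite rmorphM. Qed.

Lemma atildeM x y : totpos sigma x -> totpos sigma y ->
  atilde sigma (x * y) = atilde sigma x *m atilde sigma y.
Proof.
move=> xp yp; rewrite /atilde normKM powRM ?prodr_ge0 // => [|j _|j _]; try exact: ltW.
rewrite -scalemxAl -scalemxAr scalerA mulmx_diag; congr (_ *: diag_mx _).
by apply/rowP => j; rewrite !mxE rmorphM.
Qed.

Lemma atilde_class_stab b (I : set L) x : Zbasis b I -> frac_ideal alpha I ->
  0 < \det (emb b) -> totpos sigma x ->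
  atilde_class alpha sigma x = coset_pt (stab (rescale (emb b))) (atilde sigma x).
Proof.
move=> bI II dp xp; apply/seteqP; split=> [_ [u Uu <-]|_ [m hm <-]].
  have [_ _ up] := Uu; exists (atilde sigma u); last by rewrite atildeM.
  by apply/(stab_units _ bI II dp); exists u.
have [u Uu ->] := (stab_units _ bI II dp).1 hm; exists u => //.
by case: Uu => _ _ up; rewrite atildeM.
Qed.

(** * From a point of the intersection to a field element and an integer matrix *)

Lemma lead_coord_ratr x : exists q : rat, tau x = ratr q.
Proof.
have [c ->] := rat_coords x; exists (c 0 o0).
exact: (lead_coord_rat (fun k => c 0 k)).
Qed.

Lemma lead_coord_sum (c : 'I_3 -> rat) (f : 'I_3 -> L) :
  tau (\sum_k c k *: f k) = \sum_k ratr (c k) * tau (f k).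
Proof. by rewrite !sum3E !lead_coordD !lead_coordZ. Qed.

(* x is found by inverting the matrix of the tau (alpha^(2-k) * b i), which is
   rational and, as a real matrix, the product B0 * diag(v) * (emb b)^T. *)
Lemma exists_dual b : \det (emb b) != 0 ->
  exists x, forall i, tau (b i * x) = (i == o0)%:R.
Proof.
move=> d0; have [f hf] := choice lead_coord_ratr.
pose S := \matrix_(k, i) f (pb k * b i) : 'M[rat]_3.
have eS : map_mx ratr S = B0 *m diag_mx v^T *m (emb b)^T :> 'M[R]_3.
  apply/matrixP => k i; rewrite !mxE -hf; apply: eq_bigr => j _.
  by rewrite mul_mx_diag !mxE rmorphM mulrAC.
have SU : S \in unitmx.
  rewrite -(map_unitmx (ratr : {rmorphism rat -> R})) eS !unitmx_mul B0_unit unitmx_tr.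
  rewrite [emb b \in _]unitmxE unitfE d0 andbT unitmxE det_diag unitfE.
  by apply/prodf_neq0 => j _; rewrite mxE; apply: dual_vec_neq0.
exists (\sum_k invmx S o0 k *: pb k) => i.
rewrite mulr_sumr; under eq_bigr do rewrite -scalerAr mulrC.
rewrite lead_coord_sum; transitivity (ratr ((invmx S *m S) o0 i) : R).
  by rewrite mxE rmorph_sum; apply: eq_bigr => k _; rewrite rmorphM /= hf mxE.
by rewrite mulVmx // mxE eq_sym ratr_nat.
Qed.

Lemma act_basisE M b i : act_basis M b i = \sum_k b k *~ M i k. Proof. by []. Qed.

Lemma Zbasis_unimodular b (I : set L) g : Zbasis b I -> \det g = 1 -> \det (emb b) != 0 ->
  Zbasis (act_basis g b) I.
Proof.
move=> bI dg d0; have gU := mx3_unit_det1 dg; have [h _] := bI; split=> [x|c].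
  split=> [/h[c ->]|[c ->]]; last by rewrite sum_act_basis; apply/h; eexists.
  (* The coefficient vector is repeated in every row, as [act_basis] takes square matrices; one row
     is read back. *)
  pose X := \matrix_(i < 3, k < 3) c k.
  exists ((X *m invmx g) o0).
  rewrite -(act_basisE _ (act_basis g b)) act_basisM mulmxKV //.
  by apply: eq_bigr => k _; rewrite mxE.
pose X := \matrix_(i < 3, k < 3) c k => c0.
have : X *m g = 0.
  apply: (act_basis_inj d0) => i; rewrite -act_basisM.
  transitivity (0 : L); last by rewrite /act_basis big1 // => k _; rewrite mxE mulr0z.
  by rewrite -c0; apply: eq_bigr => k _; rewrite mxE.
move/(congr1 (mulmx^~ (invmx g))); rewrite mulmxK // mul0mx => X0 i.
by have /matrixP/(_ o0 i) := X0; rewrite !mxE.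
Qed.

(** Both a v and diag(x) v are carried by the basis matrix to multiples of the first unit vector,
    where x is the dual element of the basis. That matrix is invertible and [v] has no zero entry,
    so [a] is a positive multiple of diag(x); this makes x totally positive. *)
Lemma torus_horo_ideal b (I : set L) (a p : 'M[R]_3) t :
  Zbasis b I -> frac_ideal alpha I -> 0 < \det (emb b) -> torus a -> P0 p ->
  coset_pt (@Gamma R) (rescale (emb b) *m a *m invmx (rescale B0)) =
    coset_pt (@Gamma R) (p *m a_ t) ->
  exists x g m1 m2 mu1 mu2 lam,
  [/\ [/\ totpos sigma x, ideal_inv alpha I x & a = atilde sigma x],
      \det g = 1, root_data (cubic a1 a2 a3) m1 m2 mu1 mu2,
      ideal_cond a1 a2 a3 m1 m2 mu1 mu2 lam &
      (fun i => x * act_basis g b i) =1 act_basis (ideal_mx a1 m1 m2 mu1 mu2 lam) pb].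
Proof.
move=> bI II dp At Pp e.
have [_ [g1 dg1 <-] eg1] := (coset_ptP _ _ (Gamma_group R)).1 (esym e).
(* Moving the Gamma factor into the basis makes the representative equal to p a(t) itself. *)
pose b1 := act_basis g1 b.
have dp1 : 0 < \det (emb b1) by rewrite det_emb_act dg1 mul1r.
have bI1 : Zbasis b1 I by apply: Zbasis_unimodular; rewrite ?gt_eqF.
have [x hx] := exists_dual (lt0r_neq0 dp1).
have [d [ed dpos d1]] := (torusP a).1 At.
have [k kp ek] : exists2 k : R, 0 < k & emb b1 *m a *m v = k *: delta_mx o0 0.
  have [c cp [ec _]] := rescale_pos dp1; have [c0 c0p [ec0 _]] := rescale_pos sigma_order.
  exists (expR (- 2 * t) / (c / c0)); first by rewrite !divr_gt0 ?expR_gt0.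
  have := col0_P0_a t Pp; rewrite eg1 !mulmxA -rescale_mulGamma // -emb_act ec ec0.
  rewrite invmxZ; last by rewrite unitmxZ ?B0_unit // unitfE gt_eqF.
  rewrite -!scalemxAl -scalemxAr -!scalemxAl scalerA -!mulmxA -/v !mulmxA => h.
  by rewrite mulrC -scalerA -h scalerA mulVf ?scale1r // gt_eqF ?divr_gt0.
have hxv : emb b1 *m diag_mx (\row_j sigma j x) *m v = delta_mx o0 0.
  apply/colP => i; rewrite mxE !mxE andbT -hx; apply: eq_bigr => j _.
  by rewrite mul_mx_diag !mxE rmorphM.
have sx j : sigma j x = k^-1 * d 0 j.
  have U1 : emb b1 \in unitmx by rewrite unitmxE unitfE gt_eqF.
  have : diag_mx (\row_j sigma j x) *m v = k^-1 *: (a *m v).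
    apply: (can_inj (mulKmx U1)); rewrite mulmxA hxv -scalemxAr mulmxA ek scalerA mulVf ?scale1r //.
    by rewrite gt_eqF.
  rewrite ed; move: (dual_vec_neq0 j); move: (v) => u u0 /colP/(_ j).
  by rewrite !mul_diag_mx !mxE mulrA => /(mulIf u0).
have xp : totpos sigma x by move=> j; rewrite sx mulr_gt0 ?invr_gt0.
have ax : a = atilde sigma x.
  have [c cp [ec Ac]] := atilde_torus xp.
  apply: (det1_proportional_eq (torus_det Ac) (torus_det At) (k := k / c)).
  rewrite ec scalerA divfK ?gt_eqF // ed; apply/matrixP => i j; rewrite !mxE sx.
  by rewrite mulrnAr mulVKf // gt_eqF.
(* The alpha^2-coefficient of alpha^n y x is the first coordinate of alpha^n y in the basis [b1], an
   integer. *)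
have xI : ideal_inv alpha I x.
  move=> y Iy; apply: Zalpha_lead_coord => n.
  have In : I (alpha ^+ n * y).
    have [_ IM _ _] := II; elim: n => [|n IH]; first by rewrite expr0 mul1r.
    by rewrite exprS -mulrA; apply: IM => //; apply: Zalpha_alpha.
  have [c ec] := (bI1.1 _).1 In; exists (c o0).
  rewrite mulrCA ec mulr_sumr sum3E !mulrzAr !lead_coordD !lead_coordMz.
  by rewrite ![x * _]mulrC !hx !eqxx mulr1 !mulr0 !addr0.
have [M eM] : exists M, (fun i => x * b1 i) =1 act_basis M pb.
  have hc i : exists c : 'I_3 -> int, x * b1 i = \sum_k pb k *~ c k.
    by apply/Zalpha_comb/xI; rewrite -(act_basis1 b1 i); apply: Zbasis_mem.
  have [c hc'] := choice hc; exists (\matrix_(i, k) c i k) => i; rewrite hc'.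
  by apply: eq_bigr => l _; rewrite mxE.
have M0 i : M i o0 = (i == o0)%:R.
  apply: (@intr_inj R); rewrite -[RHS]/((_ : int)%:~R) rmorph_nat -hx mulrC eM.
  rewrite /act_basis; under eq_bigr => l _ do rewrite -scaler_int.
  by rewrite (lead_coord_rat (fun l => (M i l)%:~R)) ratr_int.
have Mp : 0 < \det M.
  rewrite -(ltr0z R) -(pmulr_lgt0 _ sigma_order) -det_emb_act -(emb_ext eM) det_emb_scale.
  by rewrite mulr_gt0 // prodr_gt0 // => j _; apply: xp.
have [g2 dg2 [w00 w10 w20 w21 [w11 w22]]] := hnf_of_primitive (M0 o0) (M0 o1) (M0 o2) Mp.
pose W := g2 *m M; pose b2 := act_basis (g2 *m g1) b.
have dg : \det (g2 *m g1) = 1 by rewrite det_mulmx dg1 dg2 mulr1.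
have eW : (fun i => x * b2 i) =1 act_basis W pb.
  move=> i; rewrite /b2 -act_basisM -act_scale -/b1 -act_basisM.
  exact: eq_act_basis.
have bI2 : Zbasis b2 I by apply: Zbasis_unimodular; rewrite ?gt_eqF.
have [X eX] : exists X, (fun i => alpha * b2 i) =1 act_basis X b2.
  apply: (Zbasis_act bI2) => i; have [_ IM _ _] := II.
  by apply: IM; [exact: Zalpha_alpha|rewrite -(act_basis1 b2 i); apply: Zbasis_mem].
have WX : W *m companion a1 a2 a3 = X *m W.
  apply: (@act_basis_inj pb); first by rewrite gt_eqF.
  move=> i; rewrite -ideal_pb_act -eW mulrCA eX -act_scale (eq_act_basis _ eW).
  by rewrite act_basisM.
have [m1 [m2 [mu1 [mu2 [lam [m1p m2p eWm hc]]]]]] := ideal_mx_cond w00 w10 w20 w21 w11 w22 WX.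
exists x, (g2 *m g1), m1, m2, mu1, mu2, lam; split=> //.
  have [h1 h2] := ideal_cond_roots hc; by split=> //; apply: ideal_cond_coprime hc.
by rewrite -eWm.
Qed.

(** * From an integer matrix to a fractional ideal in a narrow class *)

Definition int_span b : set L := [set x | exists c : 'I_3 -> int, x = \sum_i b i *~ c i].

Lemma int_span_Zbasis b : \det (emb b) != 0 -> Zbasis b (int_span b).
Proof.
move=> d0; split=> // c c0 i; pose X := \matrix_(i < 3, k < 3) c k.
suff X0 : X = 0 by have /matrixP/(_ o0 i) := X0; rewrite !mxE.
apply: (act_basis_inj d0) => j.
transitivity (0 : L); last by rewrite /act_basis big1 // => k _; rewrite mxE mulr0z.
by rewrite -c0; apply: eq_bigr => k _; rewrite mxE.
Qed.

(** The matrix relation is stability under alpha, hence under Z[alpha]. The lattice lies in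
    Z[alpha], so 1 serves as denominator. *)
Lemma int_span_frac_ideal M X : \det M != 0 ->
  M *m companion a1 a2 a3 = X *m M -> frac_ideal alpha (int_span (act_basis M pb)).
Proof.
move=> dM eX; set w := act_basis M pb.
have dw : \det (emb w) != 0.
  by rewrite det_emb_act mulf_neq0 ?intr_eq0 // gt_eqF.
have JB x y : int_span w x -> int_span w y -> int_span w (x - y).
  move=> [c ->] [d ->]; exists (fun i => c i - d i).
  by rewrite -sumrB; apply: eq_bigr => i _; rewrite mulrzBr.
have J0 : int_span w 0 by exists (fun=> 0); rewrite big1.
have JD x y : int_span w x -> int_span w y -> int_span w (x + y).
  by move=> hx hy; rewrite -(opprK y) -[- y]add0r; apply: (JB) => //; apply: (JB).
have JMz x n : int_span w x -> int_span w (x *~ n).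
  move=> [c ->]; exists (fun i => c i * n); rewrite mulrz_suml.
  by apply: eq_bigr => i _; rewrite mulrzA.
have Ja x : int_span w x -> int_span w (alpha * x).
  move=> [c ->]; rewrite mulr_sumr.
  under eq_bigr => i _ do rewrite mulrzAr ideal_pb_act eX -act_basisM.
  by rewrite sum_act_basis; eexists.
split=> //.
- move=> z x /Zalpha_comb[c ->] Jx; rewrite mulr_suml sum3E.
  have Jpb k : int_span w (pb k * x).
    rewrite /power_basis; elim: (2 - k)%N => [|n IH]; first by rewrite expr0 mul1r.
    by rewrite exprS -mulrA; apply: Ja.
  by apply: (JD); [apply: (JD)|]; rewrite mulrzAl; apply: (JMz).
- exists (w o0); last exact: basis_neq0.
  exists (fun k => (k == o0)%:R).
  by rewrite (bigD1 o0) //= big1 ?addr0 // => k /negbTE ->; rewrite mulr0z.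
- exists 1; first exact: oner_neq0.
  by move=> x [c ->]; rewrite mul1r sum_act_basis; apply/Zalpha_comb; eexists.
Qed.

(** Dividing w by eta gives a basis of I, and total positivity of eta preserves its orientation;
    narrow equivalence is what excludes determinant -1. *)
Lemma narrow_equiv_bases b w (I : set L) eta : totpos sigma eta ->
  Zbasis b I -> Zbasis w [set eta * x | x in I] ->
  0 < \det (emb b) -> 0 < \det (emb w) ->
  exists2 g, \det g = 1 & (fun i => eta * act_basis g b i) =1 w.
Proof.
move=> ep bI wJ dp dw.
have e0 : eta != 0 by apply: contraTneq (ep o0) => ->; rewrite rmorph0 ltxx.
have wI i : I (eta^-1 * w i).
  have : [set eta * x | x in I] (w i).
    by rewrite -(act_basis1 w i); apply: Zbasis_mem.
  by case=> y Iy <-; rewrite mulKf.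
have [g eg] := Zbasis_act bI wI.
have [N eN] : exists N, (fun i => eta * b i) =1 act_basis N w.
  apply: Zbasis_act wJ _ => i; exists (b i) => //.
  by rewrite -(act_basis1 b i); apply: Zbasis_mem.
have dw' : 0 < \det (emb (fun i => eta^-1 * w i)).
  rewrite det_emb_scale mulr_gt0 // prodr_gt0 // => j _.
  by rewrite fmorphV invr_gt0; apply: ep.
have [dg _] : \det g = 1 /\ N *m g = 1%:M.
  by apply: (change_basis_det dp dw' eg) => i; rewrite act_scale -eN mulKf.
by exists g => // i; rewrite -eg mulVKf.
Qed.

(** * Coincidences of points and their horospherical times *)

Lemma frac_ideal_scale (I : set L) y : y != 0 -> frac_ideal alpha I ->
  frac_ideal alpha [set y * x | x in I].
Proof.
move=> y0 [IB IM [x Ix x0] [d d0 Id]]; split.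
- by move=> _ _ [z Iz <-] [w Iw <-]; exists (z - w); [exact: IB|rewrite mulrBr].
- by move=> z _ Zz [w Iw <-]; exists (z * w); [exact: IM|rewrite mulrCA].
- by exists (y * x); [exists x|rewrite mulf_neq0].
- exists (d / y); first by rewrite mulf_neq0 ?invr_eq0.
  by move=> _ [w Iw <-]; rewrite mulrA divfK //; apply: Id.
Qed.

(** Equality of points makes x b a positive real multiple r of x' b2, with b2 a basis of I'. The
    ratio y of first elements has all conjugates equal to r, so y x' is totally positive and y x' I'
    = x I. *)
Lemma A_rep_coset_narrow b b' (I I' : set L) x x' :
  Zbasis b I -> Zbasis b' I' -> 0 < \det (emb b) -> 0 < \det (emb b') ->
  totpos sigma x -> totpos sigma x' ->
  coset_pt (@Gamma R) (A_rep b x) = coset_pt (@Gamma R) (A_rep b' x') ->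
  narrow_equiv sigma I' [set x * z | z in I].
Proof.
move=> bI bI' dp dp' xp xp' /(coset_ptP _ _ (Gamma_group R))[_ [g dg <-]].
rewrite -A_rep_Gamma //; pose b2 := act_basis g b'.
have dp2 : 0 < \det (emb b2) by rewrite det_emb_act dg mul1r.
have bI2 : Zbasis b2 I' by apply: Zbasis_unimodular; rewrite ?gt_eqF.
have [_ _ [_ d0]] := rescale_pos sigma_order.
have [c1 c1p [ec1 _]] := rescale_pos dp; have [c2 c2p [ec2 _]] := rescale_pos dp2.
have [k1 k1p [ek1 _]] := atilde_torus xp; have [k2 k2p [ek2 _]] := atilde_torus xp'.
rewrite /A_rep -/b2 ec1 ec2 ek1 ek2.
have U0 : invmx (rescale B0) \in unitmx.
  by rewrite unitmx_inv mx3_unit_det1.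
move=> /(can_inj (mulmxK U0)); rewrite -!scalemxAl -!scalemxAr !scalerA -!emb_scale => h.
pose r := c2 * k2 / (c1 * k1); have rp : 0 < r by rewrite divr_gt0 ?mulr_gt0.
have eqr : emb (fun i => x * b i) = r *: emb (fun i => x' * b2 i).
  have q0 : c1 * k1 != 0 by rewrite gt_eqF ?mulr_gt0.
  by apply: (scalerI q0); rewrite h scalerA /r mulrCA mulfV ?mulr1.
have x'0 : x' != 0 by apply: contraTneq (xp' o0) => ->; rewrite rmorph0 ltxx.
have b20 := basis_neq0 o0 (lt0r_neq0 dp2).
pose y := x * b o0 / (x' * b2 o0).
have sy j : sigma j y = r.
  have /matrixP/(_ o0 j) := eqr; rewrite !mxE /y fmorph_div => ->.
  by rewrite mulfK // fmorph_eq0 mulf_neq0.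
have ey : (fun i => x * b i) =1 (fun i => y * x' * b2 i).
  apply: emb_inj; rewrite eqr; apply/matrixP => i j; by rewrite !mxE -mulrA [in RHS]rmorphM sy.
exists (y * x'); first by move=> j; rewrite rmorphM sy mulr_gt0.
have comb c : x * (\sum_i b i *~ c i) = y * x' * (\sum_i b2 i *~ c i).
  by rewrite !mulr_sumr; apply: eq_bigr => i _; rewrite !mulrzAr ey.
apply/seteqP; split=> [_ [z Iz <-]|_ [z Iz <-]].
  have [c ->] := (bI.1 _).1 Iz; rewrite comb; eexists=> //.
  by apply/(bI2.1 _); eexists.
have [c ->] := (bI2.1 _).1 Iz; rewrite -comb; eexists=> //.
by apply/(bI.1 _); eexists.
Qed.

(** The first column of the integer matrix M of x b may have content m > 1. The time of the point
    then satisfies exp(6t) = det M / m^3, which is at most the norm det M, so the bound on t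
    survives. *)
Lemma A_rep_horo b (I : set L) x T : Zbasis b I -> 0 < \det (emb b) ->
  ideal_inv alpha I x -> totpos sigma x ->
  normK sigma x * ideal_norm alpha sigma b <= expR (6 * T) ->
  exists2 t, t <= T & horo_orbit t (coset_pt (@Gamma R) (A_rep b x)).
Proof.
move=> bI dp xI xp hT.
have [M eM] : exists M, (fun i => x * b i) =1 act_basis M pb.
  have hc i : exists c : 'I_3 -> int, x * b i = \sum_k pb k *~ c k.
    by apply/Zalpha_comb/xI; rewrite -(act_basis1 b i); apply: Zbasis_mem.
  have [c hc'] := choice hc; exists (\matrix_(i, k) c i k) => i; rewrite hc'.
  by apply: eq_bigr => l _; rewrite mxE.
have eN : normK sigma x * ideal_norm alpha sigma b = (\det M)%:~R.
  have := congr1 determinant (emb_ext eM); rewrite det_emb_scale det_emb_act => h.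
  by rewrite /ideal_norm !gtr0_norm // mulrA h mulfK // gt_eqF.
have [c cp eA] := A_rep_act dp xp eM; have d1 := A_rep_det1 dp xp.
have Mp : 0 < \det M.
  rewrite -(ltr0z R) -eN mulr_gt0 ?divr_gt0 ?normr_gt0 ?gt_eqF //.
  by apply: prodr_gt0 => j _; apply: xp.
have col0 : M *m delta_mx o0 0 != 0 :> 'cV_3.
  apply: contraTneq Mp => /colP e; rewrite det3E.
  have z i : M i o0 = 0.
    have := e i; rewrite mxE sum3E !mxE /= !(mulr0, mulr1, addr0) //.
  by rewrite !z !(mul0r, mulr0, subr0, addr0, oppr0) ltxx.
have [g [m [dg mp em]]] := primitive_col col0.
have Mm : 0 < m%:~R :> R by rewrite ltr0z.
(* Chosen so that exp(-2t) is the factor c m in the first column after moving by g. *)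
pose t := - ln (c * m%:~R) / 2.
have et : expR (- 2 * t) = c * m%:~R.
  rewrite (_ : - 2 * t = ln (c * m%:~R)) ?lnK ?posrE ?mulr_gt0 //.
  by rewrite /t; field.
pose p := map_mx intr g *m A_rep b x *m invmx (a_ t).
have pa : p *m a_ t = map_mx intr g *m A_rep b x by rewrite mulmxKV ?a_unit.
have c3 : c ^+ 3 * (\det M)%:~R = 1 by rewrite -[RHS]d1 eA detZ det_map_mx.
exists t.
  have : expR (6 * t) <= expR (6 * T); last by rewrite ler_expR; lra.
  apply: le_trans hT; rewrite eN.
  have e6 : expR (6 * t) * (c * m%:~R) ^+ 3 = 1.
    by rewrite -et -expRM_natl -expRD -[RHS]expR0; congr expR; ring.
  rewrite -(ler_pM2r (exprn_gt0 3 (mulr_gt0 cp Mm))) e6 exprMn mulrA [_ * c ^+ 3]mulrC c3 mul1r.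
  by rewrite exprn_ege1 // ler1z.
exists p.
  split.
    rewrite /p 2!det_mulmx d1 det_inv (torus_det (a_torus t)) det_map_mx dg.
    by rewrite invr1 !mulr1.
  have {}em : map_mx intr g *m (map_mx intr M *m delta_mx o0 0) =
      m%:~R *: delta_mx o0 0 :> 'cV[R]_3.
    have := congr1 (map_mx (intr : int -> R)) em.
    rewrite !map_mxM map_delta_mx map_mxZ map_delta_mx => ->.
    by congr (_ *: delta_mx _ _).
  have ca : invmx (a_ t) *m delta_mx o0 0 = (c * m%:~R)^-1 *: delta_mx o0 0 :> 'cV[R]_3.
    apply: (can_inj (mulKmx (a_unit t))); rewrite mulKVmx ?a_unit // -scalemxAr.
    apply/colP => i; rewrite [RHS]mxE mulmx3E !mxE /= -et !(mulr0, mulr1, addr0).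
    elim/ord3_ind: i; rewrite /= ?mulr0 //.
    by rewrite mulVf // gt_eqF ?expR_gt0.
  rewrite colE (_ : (0 : 'I_3) = o0); last exact: val_inj.
  rewrite /p eA -!mulmxA ca -!scalemxAr -!scalemxAl -!scalemxAr em !scalerA.
  rewrite -mulrA mulVf ?scale1r // gt_eqF ?mulr_gt0 //.
rewrite pa; apply/(coset_ptP _ _ (Gamma_group R)).
by exists (map_mx intr g) => //; exists g.
Qed.

Lemma int_span_Zalpha M x : int_span (act_basis M pb) x -> Zalpha alpha x.
Proof. by move=> [c ->]; rewrite sum_act_basis; apply/Zalpha_comb; eexists. Qed.

(** The given bases may have negative determinant. Negating all three elements reverses the
    orientation and keeps everything the theorem uses: the ideal, the rescaled matrix and the
    norm. *)
Lemma positive_basis b (I : set L) : Zbasis b I -> frac_ideal alpha I ->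
  exists b', [/\ Zbasis b' I, 0 < \det (emb b'), rescale (emb b') = rescale (emb b) &
    ideal_norm alpha sigma b' = ideal_norm alpha sigma b].
Proof.
move=> bI II; have := Zbasis_det_neq0 II bI; rewrite neq_lt => /orP[dn|dp]; last by exists b.
have eN : emb (fun i => - b i) = - emb b.
  by apply/matrixP => i j; rewrite !mxE rmorphN.
have dN : \det (- emb b) = - \det (emb b) by rewrite !det3E !mxE; ring.
exists (fun i => - b i); split; last 3 first.
- by rewrite eN dN oppr_gt0.
- by rewrite eN rescaleN.
- by rewrite /ideal_norm eN dN normrN.
have sN (c : 'I_3 -> int) : \sum_i (- b i) *~ c i = \sum_i b i *~ (- c i).
  by apply: eq_bigr => i _; rewrite mulNrz mulrNz.
have [h1 h2] := bI; split=> [x|c]; last first.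
  by rewrite sN => /h2 c0 i; apply: oppr_inj; rewrite c0 oppr0.
split=> [/h1[c ->]|[c ->]]; last by rewrite sN; apply/h1; eexists.
by exists (fun i => - c i); rewrite sN; apply: eq_bigr => i _; rewrite opprK.
Qed.

(** Conjugating the Gamma factor by the basis matrix gives the quotient of the two torus elements,
    which lies in the torus and therefore in the stabiliser. *)
Lemma A_rep_coset_class b (I : set L) x x' :
  Zbasis b I -> frac_ideal alpha I -> 0 < \det (emb b) ->
  totpos sigma x -> totpos sigma x' ->
  coset_pt (@Gamma R) (A_rep b x) = coset_pt (@Gamma R) (A_rep b x') <->
  atilde_class alpha sigma x = atilde_class alpha sigma x'.
Proof.
move=> bI II dp xp xp'; have [c cp [_ dr]] := rescale_pos dp.
have [_ _ [_ d0]] := rescale_pos sigma_order.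
have rU := mx3_unit_det1 dr; have r0U := mx3_unit_det1 d0.
have iU : invmx (rescale B0) \in unitmx by rewrite unitmx_inv.
have [_ _ [_ At]] := atilde_torus xp; have [_ _ [_ At']] := atilde_torus xp'.
have aU' := mx3_unit_det1 (torus_det At').
rewrite !(atilde_class_stab bI II dp) //.
rewrite (coset_ptP _ _ (Gamma_group R)) (coset_ptP _ _ (stab_group rU)).
rewrite /A_rep; set r := rescale (emb b); set r0 := invmx _.
split=> [[G GG e]|[s [[G GG <-] _] e]]; last first.
  by exists G => //; rewrite e !mulmxA mulmxV // mul1mx.
have e' : atilde sigma x = invmx r *m G *m r *m atilde sigma x'.
  apply: (can_inj (mulKmx rU)); apply: (can_inj (mulmxK iU)); rewrite e -/r -/r0.
  by rewrite -!mulmxA mulKVmx.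
exists (invmx r *m G *m r) => //; split; first by exists G.
have -> : invmx r *m G *m r = atilde sigma x *m invmx (atilde sigma x').
  by rewrite e' mulmxK.
have [_ TM TV] := torus_group R; apply: TM => //; exact: (TV _ At').2.
Qed.

(** The times agree, so the two triangular integer matrices differ by an element g of SL(3, Z). Its
    (1, 0) entry vanishes, whence m1 = g11 m1' with g11 positive; symmetry gives equality. *)
Lemma p_mx_coset_m1 m1 m2 mu1 mu2 lam m1' m2' mu1' mu2' lam' :
  0 < m1 -> 0 < m2 -> 0 < m1' -> 0 < m2' ->
  coset_pt (@Gamma R) (p_mx R a1 m1 m2 mu1 mu2 lam *m a_ (horo_time R m1 m2)) =
  coset_pt (@Gamma R) (p_mx R a1 m1' m2' mu1' mu2' lam' *m a_ (horo_time R m1' m2')) ->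
  horo_time R m1 m2 = horo_time R m1' m2' /\ m1 = m1'.
Proof.
have le n1 n2 nu1 nu2 la n1' n2' nu1' nu2' la' :
    0 < n1 -> 0 < n2 -> 0 < n1' -> 0 < n2' ->
    horo_time R n1 n2 = horo_time R n1' n2' ->
    coset_pt (@Gamma R) (p_mx R a1 n1 n2 nu1 nu2 la *m a_ (horo_time R n1 n2)) =
    coset_pt (@Gamma R) (p_mx R a1 n1' n2' nu1' nu2' la' *m a_ (horo_time R n1' n2')) ->
    n1' <= n1.
  move=> p1 p2 p1' p2' et /(coset_ptP _ _ (Gamma_group R))[_ [g dg <-]].
  rewrite !p_mx_ideal_mx // et -scalemxAr -map_mxM.
  have e0 : expR (- 2 * horo_time R n1' n2') != 0 by rewrite gt_eqF ?expR_gt0.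
  move=> /(scalerI e0) /int_mx_inj /matrixP e.
  have := e o1 o0; have := e o1 o1; rewrite !mulmx3E !mxE /= !(mulr0, mulr1, addr0).
  move=> e11 e10; rewrite -e10 mul0r add0r in e11.
  have gp : 0 < g o1 o1 by rewrite -(pmulr_lgt0 _ p1') -e11.
  by rewrite e11 ler_peMl // ltW.
move=> p1 p2 p1' p2' e.
have et : horo_time R m1 m2 = horo_time R m1' m2'.
  apply: horo_coset_time e; exact: p_mx_P0.
split=> //; apply/eqP; rewrite eq_le (le _ _ _ _ _ _ _ _ _ _ p1 p2 p1' p2' et e).
by rewrite (le _ _ _ _ _ _ _ _ _ _ p1' p2' p1 p2 (esym et) (esym e)).
Qed.

End TotallyRealCubic.

Theorem theorem1p1 (R : realType) (L : fieldExtType rat)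
  (alpha : L) (a1 a2 a3 : int) (sigma : 'I_3 -> {rmorphism L -> R})
  (h : nat) (I : 'I_h -> set L) (b : 'I_h -> 'I_3 -> L) (T : R)
  (F_irr : irreducible_poly (map_poly (intr : int -> rat) (cubic a1 a2 a3)))
  (F_alpha : root (map_poly (intr : int -> L) (cubic a1 a2 a3)) alpha)
  (L_gen : <<1; alpha>>%VS = fullv)
  (sigma_inj : forall i j, sigma i =1 sigma j -> i = j)
  (Z_max : forall x : L, integralOver (intr : int -> L) x <-> Zalpha alpha x)
  (sigma_order : 0 < \det (emb_mx sigma (power_basis alpha)))
  (I_frac : forall l, frac_ideal alpha (I l))
  (I_reps : forall J : set L, frac_ideal alpha J ->
     exists! l, narrow_equiv sigma (I l) J)
  (I_basis : forall l, Zbasis (b l) (I l)) :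
  let F := cubic a1 a2 a3 in
  let g0 := rescale (emb_mx sigma (power_basis alpha)) in
  let g := fun l => rescale (emb_mx sigma (b l)) in
  let intersection : set (set 'M[R]_3) :=
    (\bigcup_(l in [set: 'I_h]) torus_orbit (g l) g0) `&`
    (\bigcup_(t in [set t : R | t <= T]) horo_orbit t) in
  let N := fun l (xi : L) => normK sigma xi * ideal_norm alpha sigma (b l) in
  let xi_data := fun l (xi : L) => ideal_inv alpha (I l) xi /\ totpos sigma xi in
  let A_point := fun l (xi : L) =>
    coset_pt (@Gamma R) (g l *m atilde sigma xi *m invmx g0) in
  let P_class := fun m1 m2 mu1 mu2 lam =>
    coset_pt (@Gamma R) (p_mx R a1 m1 m2 mu1 mu2 lam) in
  let P_point := fun m1 m2 mu1 mu2 lam =>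
    coset_pt (@Gamma R) (p_mx R a1 m1 m2 mu1 mu2 lam *m a_ (horo_time R m1 m2)) in
  let matched := fun l xi m1 m2 mu1 mu2 lam =>
    [/\ xi_data l xi,
        root_data F m1 m2 mu1 mu2 /\ lambda_spec a1 a2 a3 m1 m2 mu1 mu2 lam,
        N l xi = (m1 ^+ 2 * m2)%:~R,
        (m1 ^+ 2 * m2)%:~R <= expR (6 * T) &
        A_point l xi = P_point m1 m2 mu1 mu2 lam] in
  [/\ (* the two objects are elements of the stated coset spaces *)
      (forall l xi, totpos sigma xi ->
         @torus R (atilde sigma xi) /\
         atilde_class alpha sigma xi = coset_pt (stab (g l)) (atilde sigma xi)) /\
      (forall m1 m2 mu1 mu2 lam, root_data F m1 m2 mu1 mu2 ->
         @P0 R (p_mx R a1 m1 m2 mu1 mu2 lam)),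
      (* lambda exists and is unique modulo m1 m2 *)
      forall m1 m2 mu1 mu2, root_data F m1 m2 mu1 mu2 ->
        exists lam, forall lam', lambda_spec a1 a2 a3 m1 m2 mu1 mu2 lam' <->
          (lam' = lam %[mod m1 * m2])%Z,
      (* the intersection is exactly the set of the points described *)
      forall x, intersection x <->
        exists l xi m1 m2 mu1 mu2 lam,
          matched l xi m1 m2 mu1 mu2 lam /\ x = A_point l xi,
      (* every first object and every second object occurs *)
      (forall l xi, xi_data l xi -> N l xi <= expR (6 * T) ->
         intersection (A_point l xi)) /\
      (forall m1 m2 mu1 mu2 lam,
         root_data F m1 m2 mu1 mu2 -> lambda_spec a1 a2 a3 m1 m2 mu1 mu2 lam ->
         (m1 ^+ 2 * m2)%:~R <= expR (6 * T) :> R ->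
         exists l xi, matched l xi m1 m2 mu1 mu2 lam) &
      (* a point determines, and is determined by, either object *)
      forall l xi m1 m2 mu1 mu2 lam l' xi' m1' m2' mu1' mu2' lam',
        matched l xi m1 m2 mu1 mu2 lam ->
        matched l' xi' m1' m2' mu1' mu2' lam' ->
        (A_point l xi = A_point l' xi' <->
           l = l' /\ atilde_class alpha sigma xi = atilde_class alpha sigma xi') /\
        (A_point l xi = A_point l' xi' <->
           [/\ m1 = m1', m2 = m2' &
               P_class m1 m2 mu1 mu2 lam = P_class m1' m2' mu1' mu2' lam'])].
Proof.
move=> F g0 g intersection N xi_data A_point P_class P_point matched.
have [bp hb] := choice (fun l => positive_basis F_alpha sigma_order (I_basis l) (I_frac l)).
have bpI l : Zbasis (bp l) (I l) by case: (hb l).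
have bpd l : 0 < \det (emb_mx sigma (bp l)) by case: (hb l).
have bpg l : g l = rescale (emb_mx sigma (bp l)) by case: (hb l).
have bpN l xi : N l xi = normK sigma xi * ideal_norm alpha sigma (bp l).
  by case: (hb l) => _ _ _ e; rewrite /N -e.
have AE l xi : A_point l xi = coset_pt (@Gamma R) (A_rep alpha sigma (bp l) xi).
  by rewrite /A_point bpg.
have matchI l xi gam m1 m2 mu1 mu2 lam : xi_data l xi -> \det gam = 1 ->
    root_data F m1 m2 mu1 mu2 -> ideal_cond a1 a2 a3 m1 m2 mu1 mu2 lam ->
    (fun i => xi * act_basis gam (bp l) i) =1
      act_basis (ideal_mx a1 m1 m2 mu1 mu2 lam) (power_basis alpha) ->
    (m1 ^+ 2 * m2)%:~R <= expR (6 * T) :> R ->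
    matched l xi m1 m2 mu1 mu2 lam.
  move=> xd dg rd hc e hT; have [m1p m2p _ _ _] := rd; have [_ xp] := xd.
  have [eP eN] := matched_points sigma_order (bpd l) xp dg m1p m2p e.
  split=> //; [by split=> //; apply/lambda_specP|by rewrite bpN|].
  by rewrite AE eP.
have match_inter l xi m1 m2 mu1 mu2 lam :
    matched l xi m1 m2 mu1 mu2 lam -> intersection (A_point l xi).
  move=> [[_ xp] [[m1p m2p _ _ _] _] _ hT eAP]; split.
    exists l => //; exists (atilde sigma xi) => //.
    by have [_ _ [_ At]] := atilde_torus xp.
  exists (horo_time R m1 m2) => /=.
    have : expR (6 * horo_time R m1 m2) <= expR (6 * T) by rewrite expR_horo_time.
    by rewrite ler_expR; lra.
  by rewrite eAP; exists (p_mx R a1 m1 m2 mu1 mu2 lam) => //; apply: p_mx_P0.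
split.
- split=> [l xi xp|m1 m2 mu1 mu2 lam [_ m2p _ _ _]]; last exact: p_mx_P0.
  have [_ _ [_ At]] := atilde_torus xp; split=> //.
  by rewrite bpg (atilde_class_stab Z_max (bpI l) (I_frac l)).
- by move=> m1 m2 mu1 mu2 rd; apply: lambda_unique.
- move=> x; split=> [[[l _ [a At ex]] [t tT [p Pp ex']]]|]; last first.
    by move=> [l [xi [m1 [m2 [mu1 [mu2 [lam [hm ->]]]]]]]]; apply: match_inter hm.
  have e := etrans ex (esym ex'); rewrite bpg in e.
  have [xi [gam [m1 [m2 [mu1 [mu2 [lam [[xp xI ea] dg rd hc ew]]]]]]]] :=
    torus_horo_ideal F_alpha L_gen Z_max sigma_order (bpI l) (I_frac l) (bpd l) At Pp e.
  have [m1p m2p _ _ _] := rd.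
  have [eP _] := matched_points sigma_order (bpd l) xp dg m1p m2p ew.
  have eA : x = A_point l xi by rewrite -ex /A_point ea.
  exists l, xi, m1, m2, mu1, mu2, lam; split=> //.
  (* The bound on m1^2 m2 follows from t <= T once t is identified with the time attached to m1,
     m2. *)
  apply: matchI ew _ => //; rewrite -expR_horo_time // ler_expR ler_pM2l //.
  rewrite (_ : horo_time R m1 m2 = t) //.
  apply: (@horo_coset_time R (p_mx R a1 m1 m2 mu1 mu2 lam) p) => //.
    exact: p_mx_P0.
  by rewrite -eP -AE -eA ex'.
- split=> [l xi [xI xp]|m1 m2 mu1 mu2 lam rd hl hT].
    rewrite bpN AE => hN; split.
      exists l => //; exists (atilde sigma xi); last by rewrite bpg.
      by have [_ _ [_ At]] := atilde_torus xp.
    have [t tT ht] := A_rep_horo F_alpha sigma_order (bpI l) (bpd l) xI xp hN.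
    by exists t.
  have [m1p m2p _ _ _] := rd; have hc := (lambda_specP rd lam).1 hl.
  have [X eX] := ideal_cond_mx hc.
  have Wp : 0 < \det (ideal_mx a1 m1 m2 mu1 mu2 lam).
    by rewrite det_ideal_mx mulr_gt0 ?exprn_gt0.
  set w := act_basis (ideal_mx a1 m1 m2 mu1 mu2 lam) (power_basis alpha).
  have dw : 0 < \det (emb_mx sigma w).
    by rewrite det_emb_act mulr_gt0 // ltr0z.
  have JJ : frac_ideal alpha (int_span w).
    by apply: (int_span_frac_ideal F_alpha sigma_order _ eX); rewrite ?gt_eqF.
  (* The lattice is eta I_l for some l. The required xi is eta itself, in the inverse of I_l because
     the lattice lies in Z[alpha]. *)
  have [l [[eta ep eJ] _]] := I_reps _ JJ.
  have wJ : Zbasis w [set eta * x | x in I l].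
    by rewrite -eJ; apply: (int_span_Zbasis (sigma := sigma)); rewrite gt_eqF.
  have [gam dg eg] := narrow_equiv_bases ep (bpI l) wJ (bpd l) dw.
  exists l, eta; apply: matchI eg hT => //; split=> //.
  move=> y Iy; apply: (int_span_Zalpha F_alpha (M := ideal_mx a1 m1 m2 mu1 mu2 lam)).
  by rewrite -/w eJ; exists y.
- move=> l xi m1 m2 mu1 mu2 lam l' xi' m1' m2' mu1' mu2' lam'.
  move=> [[xI xp] [[m1p m2p _ _ _] _] _ _ eP] [[xI' xp'] [[m1p' m2p' _ _ _] _] _ _ eP'].
  split.
    split=> [e|[el ec]]; last first.
      subst l'; rewrite !AE.
      by apply/(A_rep_coset_class Z_max sigma_order (bpI l) (I_frac l) (bpd l)).
    have xi0 : xi != 0 by apply: contraTneq (xp ord0) => ->; rewrite rmorph0 ltxx.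
    (* The ideal xi I_l is narrowly equivalent to I_l through xi, and to I_l' by equality of the
       points; uniqueness of the representative gives l = l'. *)
    have [l0 [_ ul0]] := I_reps _ (frac_ideal_scale xi0 (I_frac l)).
    have el : l = l'.
      rewrite -(ul0 l); last by exists xi.
      apply: ul0; apply: (A_rep_coset_narrow sigma_order (bpI l) (bpI l') (bpd l) (bpd l') xp xp').
      by rewrite -!AE.
    subst l'; split=> //.
    apply/(A_rep_coset_class Z_max sigma_order (bpI l) (I_frac l) (bpd l)) => //.
    by rewrite -!AE.
  rewrite eP eP'; split=> [e|[-> -> e]].
    have [et em] := p_mx_coset_m1 m1p m2p m1p' m2p' e.
    (* The common time fixes m1^2 m2, and m1 is already known to agree. *)
    have em2 : m2 = m2'.
      have : (m1 ^+ 2 * m2)%:~R = (m1' ^+ 2 * m2')%:~R :> R.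
        by rewrite -!expR_horo_time // et.
      move/intr_inj; rewrite em => /mulfI; apply.
      by rewrite expf_neq0 // gt_eqF.
    split=> //; apply/(coset_ptP _ _ (Gamma_group R)).
    have [G GG eG] := (coset_ptP _ _ (Gamma_group R)).1 e; exists G => //.
    (* Equal times let a(t) be cancelled, turning equality of points into equality of classes of
       P0-coordinates. *)
    apply: (can_inj (mulmxK (a_unit (horo_time R m1 m2)))).
    by rewrite eG et mulmxA.
  apply/(coset_ptP _ _ (Gamma_group R)).
  have [G GG eG] := (coset_ptP _ _ (Gamma_group R)).1 e.
  by exists G => //; rewrite eG mulmxA.
Qed.
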